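(* Let $N\ge 3$. For any $-\infty<a<\frac{N-2}{2}$, $0\le b-a\le 1$ and $p=\frac{2N}{N-2+2(b-a)}$, there exists a constant $C=C(a,b,N)>0$ such that $$\left(\int_{\mathbb{B}^N} d^{-bp}|u|^p\,dV\right)^{\frac{2}{p}}\le C\int_{\mathbb{B}^N} d^{-2a}|\nabla_{\mathbb{B}^N}u|^2\,dV\qquad\text{for all } u\in C_c^\infty(\mathbb{B}^N).$$
   Context: $\mathbb{B}^N$ is the Poincaré ball model of hyperbolic space: the unit ball $\{x\in\mathbb{R}^N:|x|<1\}$ with the metric $g_{ij}=\rho^2\delta_{ij}$, where $\rho(x)=\frac{2}{1-|x|^2}$. Here $\nabla_{\mathbb{B}^N}=\frac{\nabla}{\rho}$ (with $\nabla$ the Euclidean gradient, and $|\cdot|$ the Euclidean norm, so $|\nabla_{\mathbb{B}^N}u|^2=\rho^{-2}|\nabla u|^2$), $dV=\rho^N\,dx$, and $d=d(x)=\log\frac{1+|x|}{1-|x|}$ is the hyperbolic distance from $x$ to the origin. *)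

(* Defs.v *)
From HB Require Import structures.
From mathcomp Require Import all_boot all_order all_algebra.
From mathcomp Require Import all_classical all_reals all_analysis.

Set Implicit Arguments.
Unset Strict Implicit.
Unset Printing Implicit Defensive.
Import Order.TTheory GRing.Theory Num.Theory.
Import numFieldNormedType.Exports.

Local Open Scope classical_set_scope.
Local Open Scope ring_scope.

(* The product sigma-algebra on R^n, generated by the coordinate maps from the
   Borel sets of R. *)
Fact rowvec_display : measure_display. Proof. exact. Qed.

Section measurable_rowvec.
Variables (R : realType) (n : nat).

Definition rowvec_coord (i : 'I_n) (x : 'rV[R]_n) : measurableTypeR R := x ord0 i.

Let rowvec_set0 : g_sigma_preimage rowvec_coord set0.
Proof. exact: sigma_algebra0. Qed.

Let rowvec_setC A :
  g_sigma_preimage rowvec_coord A -> g_sigma_preimage rowvec_coord (~` A).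
Proof. exact: sigma_algebraC. Qed.

Let rowvec_bigcup (F : (set 'rV[R]_n)^nat) :
  (forall i, g_sigma_preimage rowvec_coord (F i)) ->
  g_sigma_preimage rowvec_coord (\bigcup_i (F i)).
Proof. exact: sigma_algebra_bigcup. Qed.

HB.instance Definition _ := @isMeasurable.Build rowvec_display 'rV[R]_n
  (g_sigma_preimage rowvec_coord) rowvec_set0 rowvec_setC rowvec_bigcup.

End measurable_rowvec.

Section rowvec_measurability.
Context {R : realType}.

Lemma measurable_rowvec_coord n (i : 'I_n) :
  measurable_fun [set: 'rV[R]_n] (rowvec_coord i).
Proof.
move=> _ Y mY; rewrite setTI; apply: sub_sigma_algebra => /=.
rewrite -bigcup_seq/=; exists i => /=; first by rewrite mem_index_enum.
by exists Y => //; rewrite setTI.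
Qed.

Lemma measurable_fun_rowvecP d (T : measurableType d) n (f : T -> 'rV[R]_n) :
  measurable_fun [set: T] f <->
  forall i, measurable_fun [set: T] (@rowvec_coord R n i \o f).
Proof.
split=> [mf i|mf].
  by apply: measurableT_comp => //; exact: measurable_rowvec_coord.
pose G := \big[setU/set0]_(i < n)
  preimage_set_system setT (@rowvec_coord R n i) measurable.
apply: (@measurability _ _ _ _ _ f G) => // _ [B + <-].
rewrite /G -bigcup_seq/= => -[i _] [Y mY <-].
by rewrite [X in _ `&` _ @^-1` X]setTI -comp_preimage; exact: mf.
Qed.

Definition rowvec_cons n (p : measurableTypeR R * 'rV[R]_n) : 'rV[R]_n.+1 :=
  row_mx (p.1)%:M p.2.

Lemma rowvec_cons0 n (p : measurableTypeR R * 'rV[R]_n) :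
  rowvec_cons p ord0 ord0 = p.1.
Proof.
transitivity (rowvec_cons p ord0 (@lshift 1 n ord0)).
  by congr (rowvec_cons p ord0 _); exact/val_inj.
by apply: etrans (row_mxEl _ _ _ _) _; rewrite mxE eqxx mulr1n.
Qed.

Lemma rowvec_consS n (p : measurableTypeR R * 'rV[R]_n) (i : 'I_n) :
  rowvec_cons p ord0 (lift ord0 i) = p.2 ord0 i.
Proof.
transitivity (rowvec_cons p ord0 (@rshift 1 n i)).
  by congr (rowvec_cons p ord0 _); exact/val_inj.
exact: row_mxEr.
Qed.

Lemma measurable_rowvec_cons n : measurable_fun setT (@rowvec_cons n).
Proof.
apply/measurable_fun_rowvecP => i; case: (unliftP ord0 i) => [j|] ->.
  rewrite (_ : _ \o _ = @rowvec_coord R n j \o snd).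
    apply: measurableT_comp; last exact: measurable_snd.
    exact: measurable_rowvec_coord.
  by apply/funext => p /=; rewrite /rowvec_coord rowvec_consS.
rewrite (_ : _ \o _ = fst); first exact: measurable_fst.
by apply/funext => p /=; rewrite /rowvec_coord rowvec_cons0.
Qed.

Lemma measurable_rowvec_uncons n : measurable_fun setT (fun x : 'rV[R]_n.+1 =>
  (x ord0 ord0, \row_i x ord0 (lift ord0 i)) : measurableTypeR R * 'rV[R]_n).
Proof.
apply/measurable_fun_pairP; split.
  exact: (@measurable_rowvec_coord n.+1 ord0).
apply/measurable_fun_rowvecP => i.
rewrite (_ : _ \o _ = @rowvec_coord R n.+1 (lift ord0 i)).
  exact: measurable_rowvec_coord.
by apply/funext => x; rewrite /rowvec_coord/= mxE.
Qed.

End rowvec_measurability.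

Section lebesgue_rowvec.
Context {R : realType}.
Local Open Scope ereal_scope.

Fixpoint lebesgue_rowvec (n : nat) : set 'rV[R]_n -> \bar R :=
  match n with
  | 0%N => \d_(0%R : 'rV[R]_0)
  | m.+1 => pushforward
      ((lebesgue_measure : set (measurableTypeR R) -> \bar R) \x
        @lebesgue_rowvec m)
      (@rowvec_cons R m)
  end.

Lemma lebesgue_rowvec_sigma_finite_measure n :
  {mu : {sigma_finite_measure set 'rV[R]_n -> \bar R} |
    mu = @lebesgue_rowvec n :> (set 'rV[R]_n -> \bar R)}.
Proof.
elim: n => [|n [mu IH]]; first by exists (\d_(0%R : 'rV[R]_0)).
rewrite /= -IH.
pose leb : {sigma_finite_measure set (measurableTypeR R) -> \bar R} :=
  lebesgue_measure.
pose nu : {measure set (measurableTypeR R * 'rV[R]_n)%type -> \bar R} :=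
  product_measure1 leb mu.
have mcons := @measurable_rowvec_cons R n.
have sf : sigma_finite setT (pushforward nu (@rowvec_cons R n)).
  have /sigma_finiteP[F [FT ndF Foo]] := sigma_finiteT leb.
  have /sigma_finiteP[G [GT ndG Goo]] := sigma_finiteT mu.
  exists (fun k => (fun x : 'rV[R]_n.+1 =>
      (x ord0 ord0, \row_i x ord0 (lift ord0 i)) :
        measurableTypeR R * 'rV[R]_n) @^-1` (F k `*` G k)).
    rewrite -preimage_bigcup (_ : \bigcup_k _ = setT) ?preimage_setT//.
    rewrite -subTset => -[x y] _.
    have [k _ Fkx] : (\bigcup_k F k) x by rewrite -FT.
    have [l _ Gly] : (\bigcup_k G k) y by rewrite -GT.
    exists (maxn k l) => //; split => /=.
    - by move: x Fkx; exact/subsetPset/ndF/leq_maxl.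
    - by move: y Gly; exact/subsetPset/ndG/leq_maxr.
  move=> k; have [mF Fk] := Foo k; have [mG Gk] := Goo k; split.
    rewrite -[X in measurable X]setTI; apply: measurable_rowvec_uncons => //.
    exact: measurableX.
  rewrite /pushforward -comp_preimage (_ : _ \o _ = id) ?preimage_id//.
    by rewrite /nu/= product_measure1E// lte_mul_pinfty// ge0_fin_numE.
  apply/funext => -[x y] /=; congr pair; first exact: rowvec_cons0.
  by apply/rowP => i; rewrite mxE rowvec_consS.
pose m : {measure set 'rV[R]_n.+1 -> \bar R} :=
  measure_function_pushforward__canonical__measure_function_Measure nu mcons.
pose H := Measure_isSigmaFinite.Build _ _ _ (Measure.sort m) sf.
by exists (HB.pack_for (SigmaFiniteMeasure.type 'rV[R]_n.+1 R)
  (Measure.sort m) H).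
Qed.

Let lebesgue_rowvec0 n : @lebesgue_rowvec n set0 = 0.
Proof.
by have [mu <-] := lebesgue_rowvec_sigma_finite_measure n; rewrite measure0.
Qed.

Let lebesgue_rowvec_ge0 n A : 0 <= @lebesgue_rowvec n A.
Proof.
by have [mu <-] := lebesgue_rowvec_sigma_finite_measure n; exact: measure_ge0.
Qed.

Let lebesgue_rowvec_sigma_additive n : semi_sigma_additive (@lebesgue_rowvec n).
Proof.
have [mu <-] := lebesgue_rowvec_sigma_finite_measure n.
exact: measure_semi_sigma_additive.
Qed.

HB.instance Definition _ n := isMeasure.Build _ _ _ (@lebesgue_rowvec n)
  (@lebesgue_rowvec0 n) (@lebesgue_rowvec_ge0 n)
  (@lebesgue_rowvec_sigma_additive n).

Let lebesgue_rowvec_sigma_finite n : sigma_finite setT (@lebesgue_rowvec n).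
Proof.
have [mu <-] := lebesgue_rowvec_sigma_finite_measure n.
exact: sigma_finiteT.
Qed.

HB.instance Definition _ n := Measure_isSigmaFinite.Build _ _ _
  (@lebesgue_rowvec n) (@lebesgue_rowvec_sigma_finite n).

End lebesgue_rowvec.

Arguments lebesgue_rowvec {R} n _.

Section smooth_functions.
Context {R : realType} {n : nat}.
Implicit Types (u : 'rV[R]_n -> R) (x : 'rV[R]_n).

Definition partial (i : 'I_n) u x : R := 'D_(delta_mx ord0 i) u x.

Definition partials (s : seq 'I_n) u : 'rV[R]_n -> R := foldr partial u s.

Definition smooth u := forall s : seq 'I_n,
  continuous (partials s u) /\
  forall (i : 'I_n) x, derivable (partials s u) x (delta_mx ord0 i).

Definition gradient u x : 'rV[R]_n := \row_i partial i u x.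

End smooth_functions.

Section poincare_ball.
Context {R : realType} {N : nat}.
Implicit Types (u : 'rV[R]_N -> R) (x : 'rV[R]_N).

(* The library norm of 'rV[R]_N is the sup norm. *)
Definition enorm x : R := Num.sqrt (\sum_(i < N) x ord0 i ^+ 2).

Definition poincare_ball : set 'rV[R]_N := [set x | enorm x < 1].

Definition rho x : R := 2 / (1 - enorm x ^+ 2).

Definition hyp_dist x : R := ln ((1 + enorm x) / (1 - enorm x)).

Definition hyp_gradient u x : 'rV[R]_N := (rho x)^-1 *: gradient u x.

Definition hyp_integral (f : 'rV[R]_N -> R) : \bar R :=
  (\int[lebesgue_rowvec N]_(x in poincare_ball) (f x * rho x ^+ N)%:E)%E.

(* A function on the ball with compact support is identified with its extension
   by 0 to R^N. *)
Definition test_function u :=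
  [/\ smooth u,
      compact (closure [set x | u x != 0]) &
      closure [set x | u x != 0] `<=` poincare_ball].

End poincare_ball.

(* Main.v *)
Require Import Defs.
From HB Require Import structures.
From mathcomp Require Import all_boot all_order all_algebra.
From mathcomp Require Import all_classical all_reals all_analysis.
From mathcomp Require Import measurable_realfun ring lra.

Set Implicit Arguments.
Unset Strict Implicit.
Unset Printing Implicit Defensive.
Import Order.TTheory GRing.Theory Num.Theory.
Import numFieldNormedType.Exports.

Local Open Scope classical_set_scope.
Local Open Scope ring_scope.

(** The inequality is obtained by interpolation between its two extreme cases, the
    weighted Sobolev inequality (b = a) and the weighted Hardy inequality
    (b = a + 1), with Hölder's inequality ([hoelder_geometric]). Write d for the
    hyperbolic distance to the origin and E for the energy, the integral of
    d^(-2a) rho^(N-2) |grad u|^2.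

    Everything happens on the shells e <= |x| < 1, with constants that do not
    depend on e: the weights are smooth there, test functions vanish near the
    outer sphere, and all integrals are finite, which allows terms to be absorbed.
    A sharp cutoff at |x| = e costs nothing since every estimate moves outward
    along coordinate lines: the norm increases, the origin is never met, and the
    boundary terms on the inner sphere have the right sign. The ball is recovered
    by monotone convergence ([integral_ball_le]).

    Hardy ([hardy_shell]). With s = -(2a + 2), the field x d^s rho^(N-1) has
    divergence at least c0 d^s rho^N, where c0 > 0 because a < (N - 2) / 2
    ([divergence_coef_ge]). The integral over the shell of
    the divergence of the field multiplied by u^2 is nonpositive, by the
    fundamental theorem of calculus on lines ([integral_line_le0]) and Tonelli's
    theorem ([integral_le0_lines]), and Young's inequality concludes.

    Sobolev ([sobolev_shell_constant]). Let g = 2 (N - 1) / (N - 2) and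
    q = 2 N / (N - 2). Along an outward coordinate ray, d^(-a g) |u|^g is bounded
    by the integral of its derivative, and the factor rho^(N-1) goes along because
    it increases ([le_ray_integral]). Gagliardo's inequality ([gagliardo_nirenberg])
    turns these bounds, in all coordinate directions, into one for the integral S
    of d^(-a q) |u|^q rho^N. By the Cauchy-Schwarz inequality, the bound involves
    the square root of S, the square root of E, and, because of the derivative of
    the weight d^(-a g), the square root of the Hardy integral, itself controlled
    by E. The power of S being less than 1, it is absorbed
    ([sobolev_selfimprove]). *)

(** * Hölder's inequality for extended nonnegative functions *)

Section hoelder_geometric.
Context d (T : measurableType d) (R : realType).
Variable mu : {measure set T -> \bar R}.
Local Open Scope ereal_scope.

Lemma measurable_fun_poweR (f : T -> \bar R) (r : R) :
  measurable_fun setT f -> measurable_fun setT (fun x => f x `^ r).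
Proof. by move=> mf; exact: (measurableT_comp (measurable_poweR r) mf). Qed.

Lemma le_poweR (x y : \bar R) (r : R) : (0 <= r)%R -> 0 <= x -> x <= y ->
  x `^ r <= y `^ r.
Proof.
move=> r0 x0 xy; apply: gt0_ler_poweR => //.
  by rewrite in_itv/= leey andbT.
by rewrite in_itv/= leey andbT (le_trans x0).
Qed.

Lemma powR_amgm (x y s : R) : (0 <= x)%R -> (0 <= y)%R -> (0 < s)%R -> (s < 1)%R ->
  (x `^ s * y `^ (1 - s) <= s * x + (1 - s) * y)%R.
Proof.
move=> x0 y0 s0 s1.
have s1' : (0 < 1 - s)%R by rewrite subr_gt0.
have := @conjugate_powR R (x `^ s)%R (y `^ (1 - s))%R s^-1%R (1 - s)^-1%R.
rewrite !invrK -!powRrM !mulfV ?gt_eqF// !powRr1// [(x * s)%R]mulrC [(y * _)%R]mulrC.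
apply; rewrite ?powR_ge0 ?invr_gt0//.
by rewrite addrC subrK.
Qed.

(** Scaling by A and B, which will be the two integrals, turns the weighted
    AM-GM inequality into a pointwise bound whose integral is Hölder's
    inequality. *)
Lemma poweR_amgm (x y : \bar R) (s A B : R) :
  0 <= x -> 0 <= y -> (0 < s)%R -> (s < 1)%R -> (0 < A)%R -> (0 < B)%R ->
  x `^ s * y `^ (1 - s) <=
    (A `^ s * B `^ (1 - s))%:E * ((s / A)%:E * x + ((1 - s) / B)%:E * y).
Proof.
move=> x0 y0 s0 s1 A0 B0.
have s1' : (0 < 1 - s)%R by rewrite subr_gt0.
have c0 : (0 < A `^ s * B `^ (1 - s))%R by rewrite mulr_gt0// powR_gt0.
have sA0 : 0 < (s / A)%:E by rewrite lte_fin divr_gt0.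
have sB0 : 0 < ((1 - s) / B)%:E by rewrite lte_fin divr_gt0.
case: x x0 => [x| |]// x0; case: y y0 => [y| |]// y0; last 3 first.
- by rewrite (gt0_muley sB0) addey// gt0_muley ?leey// lte_fin.
- by rewrite (gt0_muley sA0) addye// gt0_muley ?leey// lte_fin.
- by rewrite (gt0_muley sA0) (gt0_muley sB0) addye// gt0_muley ?leey// lte_fin.
rewrite !poweR_EFin -!EFinM lee_fin.
rewrite !lee_fin in x0 y0.
have xA : (0 <= x / A)%R by rewrite divr_ge0// ltW.
have yB : (0 <= y / B)%R by rewrite divr_ge0// ltW.
have xy := powR_amgm xA yB s0 s1.
rewrite -(ler_pM2l c0) in xy.
rewrite (_ : (s / A * x + (1 - s) / B * y = s * (x / A) + (1 - s) * (y / B))%R); last first.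
  by field; rewrite !gt_eqF.
apply: le_trans xy.
rewrite mulrACA -(powRM _ (ltW A0) xA) -(powRM _ (ltW B0) yB).
by rewrite [(A * _)%R]mulrC [(B * _)%R]mulrC !divfK// gt_eqF.
Qed.

(** When the integral of f vanishes and that of g is infinite, the right-hand
    side of Hölder's inequality is 0 * +oo = 0 and scaling is impossible; the
    left-hand side vanishes because f is zero almost everywhere. *)
Let hoelder_geometric0 (f g : T -> \bar R) (s t : R) :
  measurable_fun setT f -> measurable_fun setT g -> (forall x, 0 <= f x) ->
  (0 < s)%R -> \int[mu]_x f x = 0 ->
  \int[mu]_x (f x `^ s * g x `^ t) = 0.
Proof.
move=> mf mg f0 s0 if0.
have : ae_eq mu setT f (cst 0).
  apply/(ae_eq_integral_abs mu measurableT mf).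
  by rewrite -[RHS]if0; apply: eq_integral => x _; rewrite gee0_abs.
move=> fae.
rewrite -[RHS](integral0 mu setT).
apply: ge0_ae_eq_integral => //.
- by apply: emeasurable_funM; exact: measurable_fun_poweR.
- by move=> x _; rewrite mule_ge0// poweR_ge0.
- by apply: filterS fae => x /= fx _; rewrite fx// poweR0r ?mul0e ?gt_eqF.
Qed.

(** The endpoints s = 0 and s = 1 hold thanks to x `^ 0 = 1; they are what makes
    the final interpolation cover the extreme cases b = a and b = a + 1. *)
Lemma hoelder_geometric (f g : T -> \bar R) (s : R) :
  measurable_fun setT f -> measurable_fun setT g ->
  (forall x, 0 <= f x) -> (forall x, 0 <= g x) -> (0 <= s)%R -> (s <= 1)%R ->
  \int[mu]_x (f x `^ s * g x `^ (1 - s)) <=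
    (\int[mu]_x f x) `^ s * (\int[mu]_x g x) `^ (1 - s).
Proof.
move=> mf mg f0 g0 s0 s1.
have [->|sN0] := eqVneq s 0%R.
  rewrite subr0 poweRe0 mul1e poweRe1 ?integral_ge0//.
  rewrite le_eqVlt; apply/predU1P; left.
  by apply: eq_integral => x _; rewrite poweRe0 mul1e poweRe1.
have [->|sN1] := eqVneq s 1%R.
  rewrite subrr poweRe0 mule1 poweRe1 ?integral_ge0//.
  rewrite le_eqVlt; apply/predU1P; left.
  by apply: eq_integral => x _; rewrite poweRe0 mule1 poweRe1.
have {sN0}s0 : (0 < s)%R by rewrite lt0r sN0.
have {sN1}s1 : (s < 1)%R by rewrite lt_neqAle sN1.
have s1' : (0 < 1 - s)%R by rewrite subr_gt0.
have if0 : 0 <= \int[mu]_x f x by apply: integral_ge0.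
have ig0 : 0 <= \int[mu]_x g x by apply: integral_ge0.
have [A0|A0] := eqVneq (\int[mu]_x f x) 0.
  by rewrite hoelder_geometric0// mule_ge0// poweR_ge0.
have [B0|B0] := eqVneq (\int[mu]_x g x) 0.
  under eq_integral do rewrite muleC.
  by rewrite hoelder_geometric0// mule_ge0// poweR_ge0.
have {}A0 : 0 < \int[mu]_x f x by rewrite lt0e A0.
have {}B0 : 0 < \int[mu]_x g x by rewrite lt0e B0.
have [Aoo|Aoo] := eqVneq (\int[mu]_x f x) +oo.
  by rewrite Aoo poweRyr ?gt_eqF// gt0_mulye ?leey// poweR_gt0.
have [Boo|Boo] := eqVneq (\int[mu]_x g x) +oo.
  by rewrite Boo poweRyr ?gt_eqF// gt0_muley ?leey// poweR_gt0.
have [A EA] : exists A, \int[mu]_x f x = A%:E.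
  by exists (fine (\int[mu]_x f x)); rewrite fineK// ge0_fin_numE// ltey.
have [B EB] : exists B, \int[mu]_x g x = B%:E.
  by exists (fine (\int[mu]_x g x)); rewrite fineK// ge0_fin_numE// ltey.
rewrite EA lte_fin in A0; rewrite EB lte_fin in B0.
have mfs : measurable_fun setT (fun x => f x `^ s).
  exact: measurable_fun_poweR.
have mgs : measurable_fun setT (fun x => g x `^ (1 - s)).
  exact: measurable_fun_poweR.
have cA : (0 <= s / A)%R by rewrite divr_ge0// ltW.
have cB : (0 <= (1 - s) / B)%R by rewrite divr_ge0// ltW.
have mcf : measurable_fun setT (fun x => (s / A)%:E * f x).
  by apply: emeasurable_funM.
have mcg : measurable_fun setT (fun x => ((1 - s) / B)%:E * g x).
  by apply: emeasurable_funM.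
apply: (@le_trans _ _ (\int[mu]_x ((A `^ s * B `^ (1 - s))%:E *
    ((s / A)%:E * f x + ((1 - s) / B)%:E * g x)))).
  apply: ge0_le_integral => //.
  - by move=> x _; rewrite mule_ge0// poweR_ge0.
  - exact: emeasurable_funM.
  - by apply: emeasurable_funM => //; exact: emeasurable_funD.
  - by move=> x _; exact: poweR_amgm.
rewrite ge0_integralZl//; last 3 first.
- exact: emeasurable_funD.
- by move=> x _; rewrite adde_ge0// mule_ge0.
- by rewrite lee_fin mulr_ge0// powR_ge0.
rewrite ge0_integralD//; last 2 first.
- by move=> x _; rewrite mule_ge0.
- by move=> x _; rewrite mule_ge0.
rewrite !ge0_integralZl// EA EB !poweR_EFin -!EFinM lee_fin.
by rewrite !divfK ?gt_eqF// addrC subrK mulr1.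
Qed.

End hoelder_geometric.

(** * Tonelli's theorem and coordinate lines *)

Section tonelli.
Context {R : realType}.
Local Open Scope ereal_scope.
Notation leb := (@lebesgue_measure R).
Notation mu := (@lebesgue_rowvec R).

Lemma ge0_integral_rowvecS n (f : 'rV[R]_n.+1 -> \bar R) :
  measurable_fun setT f -> (forall x, 0 <= f x) ->
  \int[mu n.+1]_x f x =
  \int[leb \x mu n]_z f (rowvec_cons z).
Proof.
move=> mf f0.
pose nu : {measure set (measurableTypeR R * 'rV[R]_n)%type -> \bar R} :=
  product_measure1 leb (mu n).
have mc := @measurable_rowvec_cons R n.
pose m : {measure set 'rV[R]_n.+1 -> \bar R} :=
  measure_function_pushforward__canonical__measure_function_Measure nu mc.
transitivity (\int[m]_x f x); first exact: eq_measure_integral.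
transitivity (\int[pushforward nu (@rowvec_cons R n)]_x f x).
  exact: eq_measure_integral.
rewrite (ge0_integral_pushforward mc)//.
Qed.

Lemma measurable_comp_rowvec_cons n (f : 'rV[R]_n.+1 -> \bar R) :
  measurable_fun setT f -> measurable_fun setT (f \o @rowvec_cons R n).
Proof. by move=> mf; exact: measurableT_comp mf (@measurable_rowvec_cons R n). Qed.

Lemma tonelli_rowvec n (f : 'rV[R]_n.+1 -> \bar R) :
  measurable_fun setT f -> (forall x, 0 <= f x) ->
  \int[mu n.+1]_x f x = \int[leb]_t \int[mu n]_y f (rowvec_cons (t, y)).
Proof.
move=> mf f0; rewrite ge0_integral_rowvecS//.
rewrite (fubini_tonelli1 (f \o @rowvec_cons R n))//; first exact: (measurable_comp_rowvec_cons mf).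
by move=> x; exact: f0.
Qed.

Lemma tonelli_rowvec_sym n (f : 'rV[R]_n.+1 -> \bar R) :
  measurable_fun setT f -> (forall x, 0 <= f x) ->
  \int[mu n.+1]_x f x = \int[mu n]_y \int[leb]_t f (rowvec_cons (t, y)).
Proof.
move=> mf f0; rewrite ge0_integral_rowvecS//.
rewrite (fubini_tonelli2 (f \o @rowvec_cons R n))//; first exact: (measurable_comp_rowvec_cons mf).
by move=> x; exact: f0.
Qed.

Lemma measurable_slice n (f : 'rV[R]_n.+1 -> \bar R) (t : measurableTypeR R) :
  measurable_fun setT f -> measurable_fun setT (fun y : 'rV[R]_n => f (rowvec_cons (t, y))).
Proof.
move=> /measurable_comp_rowvec_cons mf.
exact: (measurableT_comp mf (pair1_measurable t)).
Qed.

Lemma measurable_slice_integral n (f : 'rV[R]_n.+1 -> \bar R) :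
  measurable_fun setT f -> (forall x, 0 <= f x) ->
  measurable_fun setT (fun t : measurableTypeR R => \int[mu n]_y f (rowvec_cons (t, y))).
Proof.
move=> mf f0.
apply: (measurable_fun_fubini_tonelli_F (f \o @rowvec_cons R n)) => //.
  exact: (measurable_comp_rowvec_cons mf).
by move=> x; exact: f0.
Qed.

Lemma measurable_line_integral n (f : 'rV[R]_n.+1 -> \bar R) :
  measurable_fun setT f -> (forall x, 0 <= f x) ->
  measurable_fun setT (fun y : 'rV[R]_n => \int[leb]_t f (rowvec_cons (t, y))).
Proof.
move=> mf f0.
apply: (measurable_fun_fubini_tonelli_G (f \o @rowvec_cons R n)) => //.
  exact: (measurable_comp_rowvec_cons mf).
by move=> x; exact: f0.
Qed.

Definition coord_upd n (x : 'rV[R]_n) (i : 'I_n) (t : R) : 'rV[R]_n :=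
  \row_j (if j == i then t else x ord0 j).

Lemma coord_upd_cons0 n (y : 'rV[R]_n) (s t : R) :
  coord_upd (rowvec_cons (s, y)) ord0 t = rowvec_cons (t, y).
Proof.
apply/rowP => j; rewrite mxE; case: (unliftP ord0 j) => [k|] ->.
  by rewrite eq_sym (negbTE (neq_lift _ _)) !rowvec_consS.
by rewrite eqxx rowvec_cons0.
Qed.

Lemma coord_upd_consS n (y : 'rV[R]_n) (s t : R) (i : 'I_n) :
  coord_upd (rowvec_cons (s, y)) (lift ord0 i) t = rowvec_cons (s, coord_upd y i t).
Proof.
apply/rowP => j; rewrite mxE; case: (unliftP ord0 j) => [k|] ->.
  by rewrite !rowvec_consS mxE (inj_eq (@lift_inj _ ord0)).
by rewrite (negbTE (neq_lift _ _)) !rowvec_cons0.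
Qed.

Lemma measurable_coord_upd n (x : 'rV[R]_n) (i : 'I_n) :
  measurable_fun setT (coord_upd x i : measurableTypeR R -> 'rV[R]_n).
Proof.
apply/measurable_fun_rowvecP => j.
have [ji|ji] := eqVneq j i.
  rewrite [X in measurable_fun _ X](_ : _ = @id (measurableTypeR R)); last first.
    by apply/funext => t; rewrite /rowvec_coord/= mxE ji eqxx.
  exact: measurable_id.
rewrite [X in measurable_fun _ X](_ : _ = cst (x ord0 j)); last first.
  by apply/funext => t; rewrite /rowvec_coord/= mxE (negbTE ji).
exact: measurable_cst.
Qed.

(** Tonelli's theorem peels off the first coordinate: it is the one to integrate
    first when i = 0, and the induction hypothesis applies to each slice
    otherwise. *)
Lemma le_integral_lines n (i : 'I_n) (f g : 'rV[R]_n -> \bar R) :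
  measurable_fun setT f -> measurable_fun setT g ->
  (forall x, 0 <= f x) -> (forall x, 0 <= g x) ->
  (forall x, \int[leb]_t f (coord_upd x i t) <= \int[leb]_t g (coord_upd x i t)) ->
  \int[mu n]_x f x <= \int[mu n]_x g x.
Proof.
elim: n i f g => [|n IH] i f g; first by case: i.
case: (unliftP ord0 i) => [j|] -> mf mg f0 g0 fg.
  rewrite !tonelli_rowvec//; apply: ge0_le_integral => //.
  - by move=> t _; exact: integral_ge0.
  - exact: measurable_slice_integral.
  - exact: measurable_slice_integral.
  - move=> t _; apply: (IH j) => //; try exact: measurable_slice.
    move=> y; have := fg (rowvec_cons (t, y)).
    under eq_integral do rewrite coord_upd_consS.
    by under [X in _ <= X -> _]eq_integral do rewrite coord_upd_consS.
rewrite !tonelli_rowvec_sym//; apply: ge0_le_integral => //.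
- by move=> t _; exact: integral_ge0.
- exact: measurable_line_integral.
- exact: measurable_line_integral.
- move=> y _; have := fg (rowvec_cons (0%R, y)).
  under eq_integral do rewrite coord_upd_cons0.
  by under [X in _ <= X -> _]eq_integral do rewrite coord_upd_cons0.
Qed.

(** This replaces the divergence theorem: with g a partial derivative, the
    hypothesis only involves the fundamental theorem of calculus. *)
Lemma integral_le0_lines n (i : 'I_n) (g : 'rV[R]_n -> \bar R) :
  measurable_fun setT g ->
  (forall x, \int[leb]_t g (coord_upd x i t) <= 0) ->
  \int[mu n]_x g x <= 0.
Proof.
move=> mg g0.
(* also true when both terms are infinite, since +oo - +oo = -oo *)
have le0P (u v : \bar R) : 0 <= u -> 0 <= v -> (u - v <= 0) = (u <= v).
  case: u => [u| |]; case: v => [v| |]//= u0 v0.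
  - by rewrite -EFinB !lee_fin subr_le0.
  by rewrite leey leNye; exact: erefl.
rewrite integralE le0P ?integral_ge0//.
apply: (le_integral_lines (i := i)) => //.
- exact: measurable_funepos.
- exact: measurable_funeneg.
- move=> x; have := g0 x; rewrite integralE le0P.
  + by congr (_ <= _); apply: eq_integral => t _; rewrite !unlock.
  + by apply: integral_ge0.
  + by apply: integral_ge0.
Qed.

End tonelli.

(** * Gagliardo's inequality *)

Section gagliardo_nirenberg.
Context {R : realType}.
Local Open Scope ereal_scope.
Notation leb := (@lebesgue_measure R).
Notation mu := (@lebesgue_rowvec R).

Lemma integral_rowvec0 (f : 'rV[R]_0 -> \bar R) :
  measurable_fun setT f -> \int[mu 0%N]_x f x = f 0%R.
Proof.
move=> mf; transitivity (\int[\d_(0%R : 'rV[R]_0)]_x f x).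
  exact: eq_measure_integral.
by rewrite integral_dirac// diracT mul1e.
Qed.

Lemma integral_rowvec1 (f : 'rV[R]_1 -> \bar R) (y : 'rV[R]_1) :
  measurable_fun setT f -> (forall x, 0 <= f x) ->
  \int[mu 1%N]_x f x = \int[leb]_t f (coord_upd y ord0 t).
Proof.
move=> mf f0; rewrite tonelli_rowvec//; apply: eq_integral => t _.
rewrite integral_rowvec0; last exact: measurable_slice.
by congr f; apply/rowP => j; rewrite !ord1 rowvec_cons0 mxE eqxx.
Qed.

(** Of the exponent 1 + e of w, the part e is spent on the bound of w by the
    integral along the first coordinate; the rest is a problem on each slice. *)
Lemma integral_poweR_slices n (w f : 'rV[R]_n.+1 -> \bar R) (e : R) :
  measurable_fun setT w -> measurable_fun setT f ->
  (forall x, 0 <= w x) -> (forall x, 0 <= f x) -> (0 < e)%R ->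
  (forall t y, w (rowvec_cons (t, y)) <= \int[leb]_s f (rowvec_cons (s, y))) ->
  (forall t, \int[mu n]_y ((\int[leb]_s f (rowvec_cons (s, y))) `^ e *
                            w (rowvec_cons (t, y))) <=
     (\int[mu n.+1]_x f x) `^ e * \int[mu n]_y f (rowvec_cons (t, y))) ->
  \int[mu n.+1]_x (w x `^ (1 + e)) <= (\int[mu n.+1]_x f x) `^ (1 + e).
Proof.
move=> mw mf w0 f0 e0 wA slice.
have mwe : measurable_fun setT (fun x => w x `^ (1 + e)) by exact: measurable_fun_poweR.
have we0 x : 0 <= w x `^ (1 + e) by exact: poweR_ge0.
have mA := measurable_line_integral mf f0.
have mB := measurable_slice_integral mf f0.
have A0 y : 0 <= \int[leb]_s f (rowvec_cons (s, y)) by apply: integral_ge0.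
have powS (z : \bar R) : 0 <= z -> z `^ (1 + e) = z `^ e * z.
  move=> z0; rewrite addrC poweRD ?poweRe1//.
  by rewrite /poweRD_def gt_eqF// addr_gt0.
rewrite (tonelli_rowvec mwe we0).
apply: (@le_trans _ _ (\int[leb]_t ((\int[mu n.+1]_x f x) `^ e *
    \int[mu n]_y f (rowvec_cons (t, y))))).
  apply: ge0_le_integral => //.
  - by move=> t _; apply: integral_ge0.
  - exact: (measurable_slice_integral mwe we0).
  - by apply: emeasurable_funM.
  - move=> t _; apply: le_trans (slice t).
    apply: ge0_le_integral => //.
    + exact: measurable_slice mwe.
    + apply: emeasurable_funM; first exact: measurable_fun_poweR.
      exact: measurable_slice mw.
    + move=> y _; rewrite powS//; apply: lee_wpmul2r => //.
      by apply: le_poweR => //; exact: ltW.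
rewrite ge0_integralZl//.
- by rewrite -tonelli_rowvec// powS// integral_ge0.
- by move=> t _; apply: integral_ge0.
- exact: poweR_ge0.
Qed.

(** The L^1 Sobolev inequality of Gagliardo and Nirenberg, in the form that its
    proof uses: w is bounded, in each coordinate direction, by a line integral of
    f. On the slice of first coordinate t, Hölder's inequality separates the line
    integral along the first coordinate from w, and the induction hypothesis
    handles w. *)
Lemma gagliardo_nirenberg n (w f : 'rV[R]_n.+2 -> \bar R) :
  measurable_fun setT w -> measurable_fun setT f ->
  (forall x, 0 <= w x) -> (forall x, 0 <= f x) ->
  (forall i x, w x <= \int[leb]_t f (coord_upd x i t)) ->
  \int[mu n.+2]_x (w x `^ (1 + n.+1%:R^-1)) <=
    (\int[mu n.+2]_x f x) `^ (1 + n.+1%:R^-1).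
Proof.
have wA m (w' f' : 'rV[R]_m.+1 -> \bar R) :
    (forall i x, w' x <= \int[leb]_t f' (coord_upd x i t)) ->
    forall t y, w' (rowvec_cons (t, y)) <= \int[leb]_s f' (rowvec_cons (s, y)).
  move=> wf t y; apply: (le_trans (wf ord0 _)).
  by under eq_integral do rewrite coord_upd_cons0.
have wB m (w' f' : 'rV[R]_m.+1 -> \bar R) :
    (forall i x, w' x <= \int[leb]_t f' (coord_upd x i t)) ->
    forall t i y, w' (rowvec_cons (t, y)) <=
      \int[leb]_s f' (rowvec_cons (t, coord_upd y i s)).
  move=> wf t i y; apply: (le_trans (wf (lift ord0 i) _)).
  by under eq_integral do rewrite coord_upd_consS.
elim: n w f => [|n IH] w f mw mf w0 f0 wf;
  (apply: integral_poweR_slices => //; [exact: wA|move=> t]).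
  (* two coordinates: w is at most the integral of f over its slice *)
  have mA := measurable_line_integral mf f0.
  have A0 y : 0 <= \int[leb]_s f (rowvec_cons (s, y)) by apply: integral_ge0.
  rewrite invr1 poweRe1 ?integral_ge0//.
  rewrite [X in _ <= X * _]tonelli_rowvec_sym//.
  rewrite -ge0_integralZr//; last by apply: integral_ge0.
  apply: ge0_le_integral => //.
  - by move=> y _; rewrite mule_ge0// poweR_ge0.
  - apply: emeasurable_funM; first exact: measurable_fun_poweR.
    exact: measurable_slice mw.
  - exact: emeasurable_funM.
  - move=> y _; rewrite poweRe1//; apply: lee_wpmul2l => //.
    rewrite (integral_rowvec1 y (measurable_slice t mf))//.
    exact: wB.
set e := (_^-1)%R.
have e0 : (0 <= e)%R by rewrite invr_ge0 ler0n.
have e1 : (e <= 1)%R by rewrite invf_le1 ?ler1n ?ltr0n.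
have ne : ((1 + n.+1%:R^-1) * (1 - e) = 1)%R.
  rewrite /e; field.
  by rewrite -(natrD _ 2 n) -(natrD _ 1 n) !pnatr_eq0.
have mA := measurable_line_integral mf f0.
have A0 y : 0 <= \int[leb]_s f (rowvec_cons (s, y)) by apply: integral_ge0.
have mwt := measurable_slice t mw.
have mft := measurable_slice t mf.
have := @hoelder_geometric _ _ R (mu n.+2) _
  (fun y => w (rowvec_cons (t, y)) `^ (1 + n.+1%:R^-1)) e mA
  (measurable_fun_poweR _ mwt) A0 (fun y => poweR_ge0 _ _) e0 e1.
under eq_integral do rewrite -poweRrM ne poweRe1//.
rewrite -tonelli_rowvec_sym// => /le_trans; apply.
apply: lee_wpmul2l; first exact: poweR_ge0.
have -> : \int[mu n.+2]_y f (rowvec_cons (t, y)) =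
    ((\int[mu n.+2]_y f (rowvec_cons (t, y))) `^ (1 + n.+1%:R^-1)) `^ (1 - e).
  by rewrite -poweRrM ne poweRe1//; apply: integral_ge0.
apply: le_poweR; first by rewrite subr_ge0.
  by apply: integral_ge0 => y _; exact: poweR_ge0.
apply: IH => //; by move=> i y; exact: wB.
Qed.

End gagliardo_nirenberg.

(** * Borel sets, null sets and the Euclidean norm of row vectors *)

Section rowvec_borel.
Context {R : realType} {n : nat}.
Implicit Types (x : 'rV[R]_n).

Let box (q : 'rV[rat]_n * nat) : set 'rV[R]_n :=
  \bigcap_(i in [set: 'I_n])
    (@rowvec_coord R n i @^-1` ball (ratr (q.1 ord0 i) : R) (q.2.+1%:R^-1 : R)).

Let measurable_box q : measurable (box q).
Proof.
apply: fin_bigcap_measurable => // i _.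
rewrite -[X in measurable X]setTI.
apply: (measurable_rowvec_coord i) => //.
exact: measurable_ball.
Qed.

(** An open set is the union of the boxes with rational center and inverse
    integer radius that it contains. *)
Lemma measurable_open_rowvec (O : set 'rV[R]_n) : open O -> measurable O.
Proof.
move=> oO.
rewrite (_ : O = \bigcup_q (if `[< box q `<=` O >] then box q else set0)).
  apply: countable_bigcupT_measurable => // q.
  by case: ifP.
apply/seteqP; split => [x Ox|x [q _]]; last by case: asboolP => // qO; exact: qO.
have /nbhs_ballP[e /= e0 xeO] := open_nbhs_nbhs (conj oO Ox).
have [k ke] : exists k, k.+1%:R^-1 < e / 2.
  have e2 : 0 < e / 2 by rewrite divr_gt0.
  exists (Num.truncn (e / 2)^-1).
  rewrite -[ltRHS]invrK ltf_pV2 ?posrE ?invr_gt0//.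
  by rewrite (lt_le_trans (truncnS_gt _)).
have k0 : 0 < k.+1%:R^-1 :> R by rewrite invr_gt0.
have qP i : exists q : rat, `|ratr q - x ord0 i| < k.+1%:R^-1.
  have /rat_in_itvoo[q] : x ord0 i < x ord0 i + k.+1%:R^-1 by rewrite ltrDl.
  rewrite in_itv/= => /andP[xq qx]; exists q.
  by rewrite ger0_norm ?subr_ge0 ?ltW// ltrBlDl.
pose q := \row_i projT1 (cid (qP i)).
have qE i : `|ratr (q ord0 i) - x ord0 i| < k.+1%:R^-1.
  by rewrite mxE; exact: projT2 (cid (qP i)).
exists (q, k) => //.
have boxO : box (q, k) `<=` O.
  move=> y qy; apply: xeO; split=> // j i; rewrite ord1 /ball/=.
  have := qy i I; rewrite /rowvec_coord /ball/= => qyi.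
  rewrite (splitr e) -(subrKA (ratr (q ord0 i))) (le_lt_trans (ler_normD _ _))//.
  by rewrite ltrD// (lt_trans _ ke)// distrC.
by case: asboolP => // _ i _; exact: qE.
Qed.

Lemma measurable_fun_continuous_rowvec (O : set 'rV[R]_n) (f : 'rV[R]_n -> R) :
  open O -> (forall x, O x -> {for x, continuous f}) -> measurable_fun O f.
Proof.
move=> oO cf; apply: (measurability _ (RGenOpens.measurableE R)).
move=> _ [_ [a [b ->] <-]]; apply: measurable_open_rowvec.
rewrite openE => x [Ox fx]; apply: filterI; first exact: open_nbhs_nbhs.
by apply: (cf x Ox); apply: open_nbhs_nbhs; split => //; exact: interval_open.
Qed.

End rowvec_borel.

Section lebesgue_rowvec_small.
Context {R : realType}.
Local Open Scope ereal_scope.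
Notation mu := (@lebesgue_rowvec R).

Lemma lebesgue_rowvec_cons n (A : set R) (B : set 'rV[R]_n) (C : set 'rV[R]_n.+1) :
  measurable A -> measurable B -> @rowvec_cons R n @^-1` C = A `*` B ->
  mu n.+1 C = lebesgue_measure A * mu n B.
Proof.
by move=> mA mB CAB; rewrite /= /pushforward CAB product_measure1E.
Qed.

Lemma measurable_coord_hyperplane n (i : 'I_n) (a : R) :
  measurable [set x : 'rV[R]_n | x ord0 i = a].
Proof.
by rewrite -[X in measurable X]setTI; exact: (@measurable_rowvec_coord R n i _ [set a]).
Qed.

Lemma measurable_rowvec_set1 n (x : 'rV[R]_n) : measurable [set x].
Proof.
rewrite (_ : [set x] = \bigcap_(i in [set: 'I_n]) [set y : 'rV[R]_n | y ord0 i = x ord0 i]).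
  by apply: fin_bigcap_measurable => // i _; exact: measurable_coord_hyperplane.
by apply/seteqP; split => [y ->//|y xy]; apply/rowP => i; exact: xy.
Qed.

Lemma lebesgue_rowvec_set1 n (x : 'rV[R]_n.+1) : mu n.+1 [set x] = 0.
Proof.
apply/eqP; rewrite -measure_le0.
apply: (@le_trans _ _ (mu n.+1 [set y : 'rV[R]_n.+1 | y ord0 ord0 = x ord0 ord0])).
  apply: le_measure; rewrite ?inE//; last by move=> y ->.
  - exact: measurable_rowvec_set1.
  - exact: measurable_coord_hyperplane.
rewrite (@lebesgue_rowvec_cons _ [set x ord0 ord0] setT)//.
  by rewrite lebesgue_measure_set1 mul0e.
by apply/seteqP; split => -[s y] /=; rewrite rowvec_cons0//= => -[].
Qed.

Definition rowvec_cube n : set 'rV[R]_n :=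
  [set x | forall i, `|x ord0 i| <= 1]%R.

Lemma measurable_rowvec_cube n : measurable (@rowvec_cube n).
Proof.
rewrite (_ : @rowvec_cube n = \bigcap_(i in [set: 'I_n])
    (@rowvec_coord R n i @^-1` [set` `[(-1)%R, 1%R]])).
  apply: fin_bigcap_measurable => // i _; rewrite -[X in measurable X]setTI.
  by apply: (measurable_rowvec_coord i) => //; exact: measurable_itv.
apply/seteqP; split => [x xP i _|x xP i].
  by rewrite /= in_itv/= -ler_norml; exact: xP.
by have := xP i I; rewrite /= in_itv/= -ler_norml.
Qed.

Lemma lebesgue_rowvec_cube_lty n : mu n (@rowvec_cube n) < +oo.
Proof.
elim: n => [|n IH].
  by rewrite /= diracE ltry.
have m1 : measurable [set` `[(-1)%R, (1:R)%R]] by exact: measurable_itv.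
rewrite (lebesgue_rowvec_cons m1 (@measurable_rowvec_cube n)).
  rewrite lebesgue_measure_itv/=; case: ifP => _; last by rewrite mul0e.
  by apply: lte_mul_pinfty; rewrite // -EFinB ?lee_fin ?opprK ?addr_ge0.
apply/seteqP; split => -[s y] /=.
  move=> sy; split => /=.
    by have := sy ord0; rewrite rowvec_cons0 in_itv/= -ler_norml.
  by move=> i; have := sy (lift ord0 i); rewrite rowvec_consS.
move=> [/=]; rewrite in_itv/= -ler_norml => s1 y1 i.
by case: (unliftP ord0 i) => [j|] ->; rewrite ?rowvec_consS ?rowvec_cons0//; exact: y1.
Qed.

End lebesgue_rowvec_small.

Section enorm.
Context {R : realType} {n : nat}.
Implicit Types (x : 'rV[R]_n).

Lemma enorm_ge0 x : 0 <= enorm x. Proof. exact: sqrtr_ge0. Qed.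

Lemma enorm_sqr x : enorm x ^+ 2 = \sum_(i < n) x ord0 i ^+ 2.
Proof. by rewrite sqr_sqrtr// sumr_ge0// => i _; exact: sqr_ge0. Qed.

Lemma coord_le_enorm x (i : 'I_n) : `|x ord0 i| <= enorm x.
Proof.
rewrite -(@ler_pXn2r _ 2)// ?nnegrE// ?enorm_ge0// enorm_sqr real_normK ?num_real//.
by rewrite (bigD1 i)//= lerDl sumr_ge0// => j _; exact: sqr_ge0.
Qed.

Lemma enorm0 : enorm (0 : 'rV[R]_n) = 0.
Proof.
by rewrite /enorm big1 ?sqrtr0// => i _; rewrite mxE expr0n.
Qed.

Lemma enorm_eq0 x : enorm x = 0 -> x = 0.
Proof.
move=> x0; apply/rowP => i; rewrite mxE; apply/eqP.
by rewrite -normr_le0 -x0 coord_le_enorm.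
Qed.

Lemma continuous_enorm : continuous (@enorm R n).
Proof.
move=> x; apply: (@continuous_comp _ _ _ (fun x : 'rV[R]_n => \sum_(i < n) x ord0 i ^+ 2) Num.sqrt).
  apply: (@continuous_big _ 'I_n +%R 0 xpredT _ _ (index_enum 'I_n)
    (fun i (y : 'rV[R]_n) => y ord0 i ^+ 2)).
    exact: add_continuous.
  move=> i _ {}x.
  apply: (@continuous_comp _ _ _ (fun x : 'rV[R]_n => x ord0 i) (fun t : R => t ^+ 2)).
    exact: coord_continuous.
  exact: exprn_continuous.
exact: sqrt_continuous.
Qed.

Lemma open_punctured_ball : open [set x : 'rV[R]_n | 0 < enorm x < 1].
Proof.
rewrite (_ : mkset _ = @enorm R n @^-1` [set` `]0, 1[]).
  by apply: open_comp; [move=> x _; exact: continuous_enorm|exact: interval_open].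
by apply/seteqP; split => x /=; rewrite in_itv.
Qed.

End enorm.

(** * Derivatives along coordinate lines *)

Section norm_powR.
Context {R : realType}.

Lemma continuous_powR_gt0 (s y : R) : 0 < y -> {for y, continuous (fun a : R => a `^ s)}.
Proof.
move=> y0; apply/differentiable_continuous/derivable1_diffP.
by apply: derivable_powR; rewrite in_itv/= y0.
Qed.

Lemma continuous_norm_powR (s : R) : 0 < s -> continuous (fun y : R => `|y| `^ s).
Proof.
move=> s0 y.
have [->|y0] := eqVneq y 0; last first.
  apply: (@continuous_comp _ _ _ (fun y : R => `|y|) (fun y : R => y `^ s)).
    exact: norm_continuous.
  by apply: continuous_powR_gt0; rewrite normr_gt0.
apply/cvgrPdist_lt => e e0; rewrite normr0 powR0 ?gt_eqF//.
near=> z; rewrite sub0r normrN ger0_norm ?powR_ge0//.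
rewrite -[ltRHS](powRr1 (ltW e0)) -(mulVf (lt0r_neq0 s0)) powRrM.
apply: gt0_ltr_powR => //; rewrite ?nnegrE ?powR_ge0//.
rewrite -[ltLHS]normrN -[X in `|X|]sub0r.
near: z; apply: (@cvgr_dist_lt _ _ _ (nbhs (0:R)) _ id 0); first exact: cvg_id.
exact: powR_gt0.
Unshelve. all: by end_near. Qed.

Lemma continuous_norm_powRM (s : R) : 0 < s -> continuous (fun y : R => `|y| `^ s * y).
Proof.
move=> s0 y; apply: cvgM.
  exact: continuous_norm_powR.
exact: cvg_id.
Qed.

(** The factor |y|^(s - 2) * y is continuous through 0 and is the Caratheodory
    slope of |y|^s at 0. *)
Lemma is_derive_norm_powR (s y : R) : 2 < s ->
  is_derive y 1 (fun y : R => `|y| `^ s) (s * (`|y| `^ (s - 2) * y)).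
Proof.
move=> s2; have s0 : 0 < s by rewrite (lt_trans _ s2).
have sB : 0 < s - 2 by rewrite subr_gt0.
have powB (z : R) : 0 < z -> z `^ (s - 1) = z `^ (s - 2) * z.
  move=> z0; rewrite -[X in _ * X](powRr1 (ltW z0)) -powRD ?(gt_eqF z0) ?implybT//.
  by congr (_ `^ _); ring.
have [y0|y0|y0] := ltgtP y 0.
- have Ny0 : 0 < - y by rewrite oppr_gt0.
  have D := is_derive1_comp (is_derive1_powR s Ny0) (is_deriveNid y 1).
  have E : \near y, ((@powR R ^~ s) \o -%R) y = `|y| `^ s.
    near=> z; rewrite /= ltr0_norm//; near: z; exact: lt_nbhsl.
  have D' : is_derive y 1 (fun y : R => `|y| `^ s) _ := near_eq_is_derive E D.
  apply: is_derive_eq D' _.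
  by rewrite powB// ltr0_norm//; ring.
- have E : \near y, (@powR R ^~ s) y = `|y| `^ s.
    by near=> w; rewrite gtr0_norm//; near: w; exact: lt_nbhsr.
  have D' : is_derive y 1 (fun y : R => `|y| `^ s) _ := near_eq_is_derive E (is_derive1_powR s y0).
  apply: is_derive_eq D' _.
  by rewrite powB// gtr0_norm.
- rewrite y0 !mulr0; apply/is_derive1_caratheodory.
  exists (fun z => `|z| `^ (s - 2) * z); split.
  + move=> z; rewrite normr0 powR0 ?gt_eqF// !subr0.
    have [->|z0] := eqVneq z 0; first by rewrite normr0 powR0 ?gt_eqF ?mulr0.
    rewrite -mulrA -expr2 -real_normK ?num_real// -powR_mulrn//.
    rewrite -powRD ?normr_eq0 ?z0 ?implybT//; congr (_ `^ _); ring.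
  + exact: continuous_norm_powRM.
  + by rewrite mulr0.
Unshelve. all: by end_near. Qed.

End norm_powR.

Section coordinate_lines.
Context {R : realType} {n : nat}.
Implicit Types (x : 'rV[R]_n) (i : 'I_n).

Lemma coord_upd_same x i t : (coord_upd x i t) ord0 i = t.
Proof. by rewrite mxE eqxx. Qed.

Lemma coord_upd_id x i : coord_upd x i (x ord0 i) = x.
Proof. by apply/rowP => j; rewrite mxE; case: eqP => // ->. Qed.

Lemma coord_updE x i s t :
  coord_upd x i (t + s) = t *: delta_mx ord0 i + coord_upd x i s.
Proof.
apply/rowP => j; rewrite !mxE eqxx/=; case: eqP => _ /=.
  by rewrite mulr1.
by rewrite mulr0 add0r.
Qed.

(** The squared distance of the line to the origin. *)
Definition off_sqr x i : R := \sum_(j < n | j != i) x ord0 j ^+ 2.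

Lemma enorm_sqr_line x i t : enorm (coord_upd x i t) ^+ 2 = off_sqr x i + t ^+ 2.
Proof.
rewrite enorm_sqr (bigD1 i)//= coord_upd_same addrC; congr (_ + _).
by apply: eq_bigr => j ji; rewrite mxE (negbTE ji).
Qed.

Lemma enorm_line x i t : enorm (coord_upd x i t) = Num.sqrt (off_sqr x i + t ^+ 2).
Proof. by rewrite -enorm_sqr_line sqrtr_sqr ger0_norm// enorm_ge0. Qed.

Lemma continuous_coord_upd x i : continuous (coord_upd x i : R -> 'rV[R]_n).
Proof.
move=> t /= A [P tP PA].
have : \forall s \near t, P ord0 i s by have := tP ord0 i; rewrite coord_upd_same.
apply: filterS => s Ps; apply: PA => k j; rewrite !ord1 mxE.
have := tP ord0 j; rewrite mxE; case: eqP => [->//|_].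
exact: nbhs_singleton.
Qed.

Lemma is_derive_line (u : 'rV[R]_n -> R) x i t :
  derivable u (coord_upd x i t) (delta_mx ord0 i) ->
  is_derive t 1 (fun s => u (coord_upd x i s)) (partial i u (coord_upd x i t)).
Proof.
move=> du.
have E : (fun h : R => h^-1 *: (((fun s => u (coord_upd x i s)) \o shift t) (h *: (1:R)) -
      u (coord_upd x i t))) =
    (fun h : R => h^-1 *: ((u \o shift (coord_upd x i t)) (h *: delta_mx ord0 i) -
      u (coord_upd x i t))).
  apply/funext => h /=; congr (_ *: (u _ - _)).
  by rewrite coord_updE [_ *: 1]mulr1.
split; first by rewrite /derivable E.
by rewrite /partial /derive E.
Qed.

Lemma is_derive_enorm_line x i t : 0 < enorm (coord_upd x i t) ->
  is_derive t 1 (fun s => enorm (coord_upd x i s)) (t / enorm (coord_upd x i t)).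
Proof.
move=> r0.
rewrite (_ : (fun s => _) = Num.sqrt \o (fun s => off_sqr x i + s ^+ 2)); last first.
  by apply/funext => s /=; rewrite enorm_line.
have q0 : 0 < off_sqr x i + t ^+ 2 by rewrite -enorm_sqr_line exprn_gt0.
have d1 : is_derive t 1 (fun s : R => off_sqr x i + s ^+ 2) (2 * t).
  by apply: is_derive_eq; rewrite add0r /GRing.scale/=; ring.
have D : is_derive t 1 (Num.sqrt \o (fun s => off_sqr x i + s ^+ 2)) _ :=
  @is_derive1_comp R Num.sqrt (fun s => off_sqr x i + s ^+ 2) t _ _ (is_derive1_sqrt q0) d1.
apply: is_derive_eq D _.
rewrite enorm_line; field.
by rewrite sqrtr_eq0 -ltNge q0.
Qed.

Lemma is_derive_rho_line x i t : enorm (coord_upd x i t) < 1 ->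
  is_derive t 1 (fun s => rho (coord_upd x i s)) (rho (coord_upd x i t) ^+ 2 * t).
Proof.
move=> r1.
have q1 : off_sqr x i + t ^+ 2 < 1.
  by rewrite -enorm_sqr_line expr_lt1// enorm_ge0.
rewrite (_ : (fun s => _) = (fun s => 2 * (1 - (off_sqr x i + s ^+ 2))^-1)); last first.
  by apply/funext => s /=; rewrite /rho enorm_sqr_line.
have q0 : 1 - (off_sqr x i + t ^+ 2) != 0 by rewrite subr_eq0 gt_eqF.
have d1 : is_derive t 1 (fun s : R => 1 - (off_sqr x i + s ^+ 2)) (- (2 * t)).
  by apply: is_derive_eq; rewrite add0r /GRing.scale/=; ring.
have d2 := @is_deriveV R (fun s => 1 - (off_sqr x i + s ^+ 2)) t _ 1 q0 d1.
apply: is_derive_eq.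
rewrite /rho enorm_sqr_line /GRing.scale/=; field.
by rewrite q0.
Qed.

Lemma is_derive_artanh (r : R) : 0 <= r -> r < 1 ->
  is_derive r 1 (fun r => ln ((1 + r) / (1 - r))) (2 / (1 - r ^+ 2)).
Proof.
move=> r0 r1.
have a0 : 0 < 1 + r by rewrite ltr_pwDl.
have b0 : 0 < 1 - r by rewrite subr_gt0.
have bN0 : 1 - r != 0 by rewrite gt_eqF.
have d1 : is_derive r 1 (fun s : R => 1 - s) (- 1).
  by apply: is_derive_eq; ring.
have d2 := @is_deriveV R (fun s => 1 - s) r _ 1 bN0 d1.
have d3 : is_derive r 1 (fun s : R => (1 + s) / (1 - s)) (2 / (1 - r) ^+ 2).
  apply: is_derive_eq; rewrite /GRing.scale/=; field.
  by rewrite bN0.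
have q0 : 0 < (1 + r) / (1 - r) by rewrite divr_gt0.
have D : is_derive r 1 (@ln R \o (fun s : R => (1 + s) / (1 - s))) _ :=
  @is_derive1_comp R (@ln R) (fun s : R => (1 + s) / (1 - s)) r _ _ (is_derive1_ln q0) d3.
apply: is_derive_eq D _; field.
rewrite bN0 (_ : 1 - r ^+ 2 = (1 - r) * (1 + r)); last by ring.
by rewrite mulf_neq0// gt_eqF.
Qed.

Lemma is_derive_hyp_dist_line x i t :
  0 < enorm (coord_upd x i t) -> enorm (coord_upd x i t) < 1 ->
  is_derive t 1 (fun s => hyp_dist (coord_upd x i s))
    (rho (coord_upd x i t) * (t / enorm (coord_upd x i t))).
Proof.
move=> r0 r1.
have D : is_derive t 1 ((fun r => ln ((1 + r) / (1 - r))) \o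
    (fun s => enorm (coord_upd x i s))) _ :=
  @is_derive1_comp R (fun r => ln ((1 + r) / (1 - r))) (fun s => enorm (coord_upd x i s)) t _ _
    (is_derive_artanh (ltW r0) r1) (is_derive_enorm_line r0).
exact: D.
Qed.

Lemma is_derive_hyp_dist_powR_line x i t (s : R) :
  0 < enorm (coord_upd x i t) -> enorm (coord_upd x i t) < 1 ->
  0 < hyp_dist (coord_upd x i t) ->
  is_derive t 1 (fun t => hyp_dist (coord_upd x i t) `^ s)
    (s * hyp_dist (coord_upd x i t) `^ (s - 1) *
      (rho (coord_upd x i t) * (t / enorm (coord_upd x i t)))).
Proof.
move=> r0 r1 d0.
have D : is_derive t 1 ((@powR R ^~ s) \o (fun t => hyp_dist (coord_upd x i t))) _ :=
  @is_derive1_comp R (@powR R ^~ s) (fun t => hyp_dist (coord_upd x i t)) t _ _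
    (is_derive1_powR s d0) (is_derive_hyp_dist_line r0 r1).
exact: D.
Qed.

End coordinate_lines.

(** * Size and continuity of the radial functions *)

Section radial_bounds.
Context {R : realType} {n : nat}.
Implicit Types (x : 'rV[R]_n).

(** The two sides agree at 0, and the derivative 2 / (1 - r^2) of the right-hand
    side is at least 2. *)
Lemma artanh_ge (r : R) : 0 <= r -> r < 1 -> 2 * r <= ln ((1 + r) / (1 - r)).
Proof.
move=> r0 r1.
pose f (s : R) := ln ((1 + s) / (1 - s)) - 2 * s.
have fd (s : R) : 0 <= s -> s < 1 -> is_derive s 1 f (2 / (1 - s ^+ 2) - 2).
  move=> s0 s1; have := is_derive_artanh s0 s1 => D.
  by apply: is_derive_eq; rewrite /GRing.scale/=; ring.
have [->|rN0] := eqVneq r 0; first by rewrite mulr0 addr0 subr0 divr1 ln1.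
have {rN0}r0 : 0 < r by rewrite lt0r rN0.
have : exists2 c, c \in `]0, r[%R & f r - f 0 = (2 / (1 - c ^+ 2) - 2) * (r - 0).
  apply: (@MVT R f (fun s => 2 / (1 - s ^+ 2) - 2)) => //.
    move=> s; rewrite in_itv/= => /andP[s0 sr].
    by apply: fd; [exact: ltW|exact: lt_trans r1].
  apply: derivable_within_continuous => s; rewrite in_itv/= => /andP[s0 sr].
  by apply: ex_derive; apply: fd => //; exact: le_lt_trans r1.
move=> [c]; rewrite in_itv/= => /andP[c0 cr].
rewrite /f addr0 mulr0 !subr0 divr1 ln1 subr0 => E.
rewrite -subr_ge0 E mulr_ge0 ?(ltW r0)//.
have c21 : 0 < 1 - c ^+ 2 by rewrite subr_gt0 expr_lt1 ?(lt_trans cr)// ltW.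
rewrite subr_ge0 ler_pdivlMr// ger_pMr ?ltr0n//.
by rewrite lerBlDl lerDr sqr_ge0.
Qed.

Lemma hyp_dist_ge x : enorm x < 1 -> 2 * enorm x <= hyp_dist x.
Proof. by move=> x1; apply: artanh_ge => //; exact: enorm_ge0. Qed.

Lemma hyp_dist_gt0 x : 0 < enorm x < 1 -> 0 < hyp_dist x.
Proof.
move=> /andP[x0 x1]; apply: (lt_le_trans _ (hyp_dist_ge x1)).
by rewrite mulr_gt0.
Qed.

Lemma rho_ge2 x : enorm x < 1 -> 2 <= rho x.
Proof.
move=> x1.
have c21 : 0 < 1 - enorm x ^+ 2 by rewrite subr_gt0 expr_lt1// enorm_ge0.
by rewrite /rho ler_pdivlMr// ger_pMr ?ltr0n// lerBlDl lerDr sqr_ge0.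
Qed.

Lemma rho_gt0 x : enorm x < 1 -> 0 < rho x.
Proof. by move=> /rho_ge2; apply: lt_le_trans. Qed.

Lemma sqr_enorm_rho x : enorm x < 1 -> enorm x ^+ 2 * rho x = rho x - 2.
Proof.
move=> x1.
have c21 : 0 < 1 - enorm x ^+ 2 by rewrite subr_gt0 expr_lt1// enorm_ge0.
by rewrite /rho; field; rewrite gt_eqF.
Qed.

Lemma le_rho (x y : 'rV[R]_n) : enorm x <= enorm y -> enorm y < 1 -> rho x <= rho y.
Proof.
move=> xy y1.
have c21 : 0 < 1 - enorm y ^+ 2 by rewrite subr_gt0 expr_lt1// enorm_ge0.
have xy2 : enorm x ^+ 2 <= enorm y ^+ 2 by rewrite ler_pXn2r// nnegrE enorm_ge0.
rewrite /rho ler_pM2l// lef_pV2 ?posrE// ?lerB//.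
by rewrite (lt_le_trans c21)// lerB.
Qed.

Lemma continuous_rho x : enorm x < 1 -> {for x, continuous (@rho R n)}.
Proof.
move=> x1; apply: (@continuous_comp _ _ _ (@enorm R n) (fun r : R => 2 * (1 - r ^+ 2)^-1)).
  exact: continuous_enorm.
apply/differentiable_continuous/derivable1_diffP; apply: ex_derive.
have q0 : 1 - enorm x ^+ 2 != 0 by rewrite gt_eqF// subr_gt0 expr_lt1// enorm_ge0.
apply: is_deriveM; apply: (@is_deriveV R (fun s => 1 - s ^+ 2) _ _ 1 q0).
Qed.

Lemma continuous_hyp_dist x : enorm x < 1 -> {for x, continuous (@hyp_dist R n)}.
Proof.
move=> x1; apply: (@continuous_comp _ _ _ (@enorm R n) (fun r : R => ln ((1 + r) / (1 - r)))).
  exact: continuous_enorm.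
apply/differentiable_continuous/derivable1_diffP; apply: ex_derive.
exact: is_derive_artanh (enorm_ge0 x) x1.
Qed.

Lemma continuous_hyp_dist_powR x s : 0 < enorm x < 1 ->
  {for x, continuous (fun x : 'rV[R]_n => hyp_dist x `^ s)}.
Proof.
move=> x01; apply: (@continuous_comp _ _ _ (@hyp_dist R n) (fun r : R => r `^ s)).
  by apply: continuous_hyp_dist; case/andP: x01.
by apply: continuous_powR_gt0; exact: hyp_dist_gt0.
Qed.

End radial_bounds.

(** * Spherical shells and outward rays *)

Section ftc_segment.
Context {R : realType}.
Notation leb := (@lebesgue_measure R).

Lemma integral_derive_segment (h g : R -> R) (s t : R) : s <= t ->
  (forall z, s <= z <= t -> is_derive z 1 h (g z)) ->
  (forall z, s <= z <= t -> {for z, continuous g}) ->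
  (\int[leb]_(z in `[s, t]) (g z)%:E = (h t - h s)%:E)%E.
Proof.
rewrite le_eqVlt => /predU1P[->|st] hg cg.
  by rewrite set_itv1 integral_set1 subrr.
have hc z : s <= z <= t -> {for z, continuous h}.
  move=> szt; apply/differentiable_continuous/derivable1_diffP.
  by have D := hg z szt; exact: ex_derive.
rewrite (@continuous_FTC2 R g h s t)//.
- apply: continuous_in_subspaceT => z; rewrite inE/= in_itv/=; exact: cg.
- split.
  + move=> z; rewrite in_itv/= => /andP[sz zt].
    have D : is_derive z 1 h (g z) by apply: hg; rewrite !ltW.
    exact: ex_derive.
  + by apply: cvg_at_right_filter; apply: hc; rewrite lexx ltW.
  + by apply: cvg_at_left_filter; apply: hc; rewrite lexx andbT ltW.
- move=> z; rewrite in_itv/= => /andP[sz zt].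
  have D : is_derive z 1 h (g z) by apply: hg; rewrite !ltW.
  by rewrite derive1E derive_val.
Qed.

End ftc_segment.

Section shells.
Context {R : realType} {n : nat}.
Implicit Types (x : 'rV[R]_n) (i : 'I_n).
Notation mu := (@lebesgue_rowvec R n).

(** The densities below are singular at the origin. Removing the ball of radius e
    makes their integrals finite; all estimates are uniform in e. *)
Definition shell (e : R) : set 'rV[R]_n := [set x | e <= enorm x < 1].

Lemma measurable_shell e : measurable (shell e).
Proof.
have lt_open (c : R) : open [set x : 'rV[R]_n | enorm x < c].
  rewrite (_ : mkset _ = @enorm R n @^-1` [set` `]-oo, c[]).
    by apply: open_comp; [move=> x _; exact: continuous_enorm|exact: interval_open].
  by apply/seteqP; split => x /=; rewrite in_itv.
rewrite (_ : shell e = [set x : 'rV[R]_n | enorm x < 1] `\` [set x : 'rV[R]_n | enorm x < e]).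
  by apply: measurableD; apply: measurable_open_rowvec.
apply/seteqP; split => x /= => [/andP[ex x1]|[x1 /negP]].
  by split => //; apply/negP; rewrite -leNgt.
by rewrite -leNgt /shell/= x1 => ->.
Qed.

Lemma shell_punctured e x : 0 < e -> shell e x -> 0 < enorm x < 1.
Proof. by move=> e0 /andP[ex ->]; rewrite (lt_le_trans e0). Qed.

Lemma measurable_fun_shell e (f : 'rV[R]_n -> R) : 0 < e ->
  (forall x, 0 < enorm x < 1 -> {for x, continuous f}) ->
  measurable_fun (shell e) f.
Proof.
move=> e0 cf; apply: (@measurable_funS _ _ _ _ [set x | 0 < enorm x < 1]).
- exact: measurable_open_rowvec open_punctured_ball.
- by move=> x; exact: shell_punctured.
- by apply: measurable_fun_continuous_rowvec => //; exact: open_punctured_ball.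
Qed.

Lemma measurable_restrict_shell e (f : 'rV[R]_n -> R) : 0 < e ->
  (forall x, 0 < enorm x < 1 -> {for x, continuous f}) ->
  measurable_fun setT ((EFin \o f) \_ (shell e)).
Proof.
move=> e0 cf; apply/(measurable_restrictT _ _).1; first exact: measurable_shell.
by apply/measurable_EFinP; exact: measurable_fun_shell.
Qed.

Lemma restrict_shell_ge0 e (f : 'rV[R]_n -> R) : 0 < e ->
  (forall x, 0 < enorm x < 1 -> 0 <= f x) ->
  forall x, (0 <= ((EFin \o f) \_ (shell e)) x)%E.
Proof.
move=> e0 f0 x; rewrite patchE; case: ifPn => //; rewrite inE.
by move=> /(shell_punctured e0); exact: f0.
Qed.

Lemma lebesgue_shell_lty e : (mu (shell e) < +oo)%E.
Proof.
apply: le_lt_trans (lebesgue_rowvec_cube_lty n).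
apply: le_measure; rewrite ?inE; [exact: measurable_shell|exact: measurable_rowvec_cube|].
by move=> x /andP[_ x1] i; rewrite (le_trans (coord_le_enorm _ _))// ltW.
Qed.

Lemma compact_closed_shell (e c : R) : compact [set x : 'rV[R]_n | e <= enorm x <= c].
Proof.
apply: bounded_closed_compact.
  exists c; split; first exact: num_real.
  move=> M cM x /andP[_ xc]; rewrite /= [X in (X <= _)%R]/Num.norm/= mx_normrE.
  apply/bigmax_leP; split => [|[k i] _ /=]; last first.
    by rewrite ord1 (le_trans (coord_le_enorm _ _))// (le_trans xc)// ltW.
  by rewrite (le_trans (enorm_ge0 x))// (le_trans xc)// ltW.
rewrite (_ : mkset _ = @enorm R n @^-1` [set` `[e, c]]).
  by apply: closed_comp; [move=> x _; exact: continuous_enorm|exact: interval_closed].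
by apply/seteqP; split => x /=; rewrite in_itv.
Qed.

(** The function f is bounded, as a continuous function on the compact set
    e <= |x| <= R0 that vanishes on the rest of the shell. *)
Lemma integrable_shell e R0 (f : 'rV[R]_n -> R) : 0 < e -> R0 < 1 ->
  (forall x, 0 < enorm x < 1 -> {for x, continuous f}) ->
  (forall x, R0 <= enorm x -> f x = 0) ->
  mu.-integrable (shell e) (EFin \o f).
Proof.
move=> e0 R01 cf f0.
apply: measurable_bounded_integrable.
- exact: measurable_shell.
- exact: lebesgue_shell_lty.
- exact: measurable_fun_shell.
have : compact (f @` [set x : 'rV[R]_n | e <= enorm x <= R0]).
  apply: continuous_compact; last exact: compact_closed_shell.
  apply: continuous_in_subspaceT => x; rewrite inE => /andP[ex xR].
  by apply: cf; rewrite (lt_le_trans e0)//= (le_lt_trans xR).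
move=> /compact_bounded[M [Mr fM]]; exists (Num.max M 0); split; first exact: num_real.
move=> B; rewrite gt_max => /andP[MB B0] x /andP[ex x1] /=.
have [xR|xR] := leP R0 (enorm x); first by rewrite f0// normr0 ltW.
by apply: (fM B MB); exists x => //=; rewrite ex ltW.
Qed.

End shells.

Section rays.
Context {R : realType} {n : nat}.
Implicit Types (x : 'rV[R]_n) (i : 'I_n).
Notation leb := (@lebesgue_measure R).

Lemma le_enorm_line x i (s t : R) :
  (enorm (coord_upd x i s) <= enorm (coord_upd x i t)) = (`|s| <= `|t|).
Proof.
rewrite -(@ler_pXn2r _ 2)// ?nnegrE ?enorm_ge0// !enorm_sqr_line lerD2l.
by rewrite -(real_normK (num_real s)) -(real_normK (num_real t)) ler_pXn2r// nnegrE.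
Qed.

Lemma enorm_lineN x i (t : R) : enorm (coord_upd x i (- t)) = enorm (coord_upd x i t).
Proof. by apply/eqP; rewrite eq_le !le_enorm_line normrN lexx. Qed.

(** A line leaves the ball of radius c < 1 before it leaves the unit ball, and
    does so after the point of parameter t0: the exit point may be chosen on the
    sphere of radius max(c, |x_t0|). *)
Lemma line_exit x i (t0 c : R) : enorm (coord_upd x i t0) < 1 -> c < 1 ->
  exists2 T, `|t0| <= T & c <= enorm (coord_upd x i T) < 1.
Proof.
move=> r1 c1; pose c' := Num.max c (enorm (coord_upd x i t0)).
have c'0 : 0 <= c' by rewrite le_max enorm_ge0 orbT.
have t0c : off_sqr x i + t0 ^+ 2 <= c' ^+ 2.
  by rewrite -enorm_sqr_line ler_pXn2r ?nnegrE// ?enorm_ge0// le_max lexx orbT.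
have T0 : 0 <= c' ^+ 2 - off_sqr x i.
  by rewrite subr_ge0 (le_trans _ t0c)// lerDl sqr_ge0.
exists (Num.sqrt (c' ^+ 2 - off_sqr x i)).
  by rewrite -sqrtr_sqr ler_wsqrtr// lerBrDl.
rewrite (_ : enorm _ = c'); first by rewrite /c' le_max lexx gt_max c1 r1.
by rewrite enorm_line sqr_sqrtr// addrC subrK sqrtr_sqr ger0_norm.
Qed.

(** G is the derivative of F in the i-th direction, away from the origin. *)
Variables (F G : 'rV[R]_n -> R) (i : 'I_n) (R0 : R).
Hypothesis dF : forall x t, 0 < enorm (coord_upd x i t) < 1 ->
  is_derive t 1 (fun s => F (coord_upd x i s)) (G (coord_upd x i t)).
Hypothesis cG : forall x, 0 < enorm x < 1 -> {for x, continuous G}.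
Hypothesis R01 : R0 < 1.
Hypothesis F0 : forall x, R0 <= enorm x -> F x = 0.
Hypothesis G0 : forall x, R0 <= enorm x -> G x = 0.

Let cGl x t : 0 < enorm (coord_upd x i t) < 1 ->
  {for t, continuous (fun s => G (coord_upd x i s))}.
Proof.
move=> xt; apply: (@continuous_comp _ _ _ (coord_upd x i) G).
  exact: continuous_coord_upd.
exact: cG.
Qed.

Lemma integral_ray_right x (t0 T : R) : 0 <= t0 -> t0 <= T ->
  0 < enorm (coord_upd x i t0) -> R0 <= enorm (coord_upd x i T) < 1 ->
  (\int[leb]_(t in `[t0, T]) (G (coord_upd x i t))%:E = (- F (coord_upd x i t0))%:E)%E.
Proof.
move=> t00 t0T r0 /andP[TR T1].
have zP z : t0 <= z <= T -> 0 < enorm (coord_upd x i z) < 1.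
  move=> /andP[tz zT]; have z0 : 0 <= z by rewrite (le_trans t00).
  rewrite (lt_le_trans r0)/= ?(le_lt_trans _ T1)// le_enorm_line !ger0_norm//.
  exact: le_trans zT.
have D z (zt : t0 <= z <= T) := dF (zP z zt).
have C z (zt : t0 <= z <= T) := cGl (zP z zt).
rewrite (@integral_derive_segment R (fun t => F (coord_upd x i t)) _ t0 T t0T D C).
by rewrite F0// sub0r.
Qed.

Lemma integral_ray_left x (t0 T : R) : t0 <= 0 -> - T <= t0 ->
  0 < enorm (coord_upd x i t0) -> R0 <= enorm (coord_upd x i T) < 1 ->
  (\int[leb]_(t in `[(- T)%R, t0]) (G (coord_upd x i t))%:E = (F (coord_upd x i t0))%:E)%E.
Proof.
move=> t00 t0T r0 /andP[TR T1].
have T0 : 0 <= T by rewrite -oppr_le0 (le_trans t0T).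
have zP z : - T <= z <= t0 -> 0 < enorm (coord_upd x i z) < 1.
  move=> /andP[Tz zt]; have z0 : z <= 0 by rewrite (le_trans zt).
  apply/andP; split.
    by apply: (lt_le_trans r0); rewrite le_enorm_line !ler0_norm// lerN2.
  by apply: le_lt_trans T1; rewrite le_enorm_line ler0_norm// ger0_norm// lerNl.
have D z (zt : - T <= z <= t0) := dF (zP z zt).
have C z (zt : - T <= z <= t0) := cGl (zP z zt).
rewrite (@integral_derive_segment R (fun t => F (coord_upd x i t)) _ (- T) t0 t0T D C).
by rewrite (F0 (x := coord_upd x i (- T))) ?subr0// enorm_lineN.
Qed.

Let mGs e : 0 < e -> measurable_fun setT ((EFin \o G) \_ (shell e)).
Proof. by move=> e0; exact: measurable_restrict_shell. Qed.

Let line_bound (K : 'rV[R]_n -> R) (f : 'rV[R]_n -> R) e x (D : set R) : 0 < e ->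
  measurable D -> measurable_fun setT ((EFin \o f) \_ (shell e)) ->
  (forall y, shell e y -> 0 <= K y) ->
  (forall y, shell e y -> K y * `|G y| <= f y) ->
  shell e x ->
  (forall t, D t -> shell e (coord_upd x i t) /\ K x <= K (coord_upd x i t)) ->
  (`| \int[leb]_(t in D) (G (coord_upd x i t))%:E | = `|F x|%:E)%E ->
  ((K x * `|F x|)%:E <= \int[leb]_t ((EFin \o f) \_ (shell e)) (coord_upd x i t))%E.
Proof.
move=> e0 mD mf K0 Kf ex DP FE.
have f0 y : (0 <= ((EFin \o f) \_ (shell e)) y)%E.
  rewrite patchE; case: ifPn => //; rewrite inE => ey /=.
  by rewrite lee_fin (le_trans _ (Kf y ey))// mulr_ge0// K0.
have mfl := measurableT_comp mf (measurable_coord_upd x i).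
have mGl := measurableT_comp (mGs e0) (measurable_coord_upd x i).
rewrite EFinM -FE.
have -> : (\int[leb]_(t in D) (G (coord_upd x i t))%:E =
    \int[leb]_(t in D) ((EFin \o G) \_ (shell e)) (coord_upd x i t))%E.
  apply: eq_integral => t; rewrite inE => /DP[et _].
  by rewrite patchE mem_set.
have Kx0 : (0 <= (K x)%:E)%E by rewrite lee_fin K0.
have mGD : measurable_fun D (fun t => ((EFin \o G) \_ (shell e)) (coord_upd x i t)).
  exact: (measurable_funTS mGl).
have mfD : measurable_fun D (fun t => ((EFin \o f) \_ (shell e)) (coord_upd x i t)).
  exact: (measurable_funTS mfl).
apply: (le_trans (lee_wpmul2l Kx0 (le_abse_integral leb mD mGD))).
rewrite -ge0_integralZl//; last exact: measurableT_comp.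
apply: (@le_trans _ _ (\int[leb]_(t in D) ((EFin \o f) \_ (shell e)) (coord_upd x i t))%E).
  apply: ge0_le_integral => //.
  - by move=> t _; rewrite mule_ge0.
  - by apply: emeasurable_funM => //; exact: measurableT_comp.
  - move=> t /DP[et Kt]; rewrite !patchE !mem_set//= lee_fin.
    by apply: le_trans (Kf _ et); rewrite ler_wpM2r.
apply: ge0_subset_integral => //.
Qed.

(** From x, follow the coordinate line in the direction that increases |x_i|
    until F vanishes. The norm increases on the way, so that the path stays in
    the shell, away from the singularity at the origin, and an increasing weight
    K can be moved under the integral without being differentiated. *)
Lemma le_ray_integral (K : 'rV[R]_n -> R) (f : 'rV[R]_n -> R) e x : 0 < e ->
  measurable_fun setT ((EFin \o f) \_ (shell e)) ->
  (forall y, shell e y -> 0 <= K y) ->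
  (forall y z, enorm y <= enorm z -> enorm z < 1 -> K y <= K z) ->
  (forall y, shell e y -> K y * `|G y| <= f y) ->
  shell e x ->
  ((K x * `|F x|)%:E <= \int[leb]_t ((EFin \o f) \_ (shell e)) (coord_upd x i t))%E.
Proof.
move=> e0 mf K0 Kmono Kf ex; have /andP[ex1 x1] := ex.
pose t0 := x ord0 i.
have x0 : 0 < enorm (coord_upd x i t0) by rewrite coord_upd_id (lt_le_trans e0).
have x1' : enorm (coord_upd x i t0) < 1 by rewrite coord_upd_id.
have [T t0T TR] := line_exit x1' R01.
have DP t : `|t0| <= `|t| <= `|T| -> shell e (coord_upd x i t) /\ K x <= K (coord_upd x i t).
  move=> /andP[]; rewrite -!(le_enorm_line x i) coord_upd_id => xt tT.
  have t1 : enorm (coord_upd x i t) < 1 by rewrite (le_lt_trans tT)//; case/andP: TR.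
  by split; [rewrite /shell/= t1 (le_trans ex1)|exact: Kmono].
have T0 : 0 <= T by rewrite (le_trans _ t0T).
have [t00|t00] := leP 0 t0.
  apply: (@line_bound K f e x [set` `[t0, T]]) => //.
  - move=> t; rewrite /= in_itv/= => /andP[tt tT]; apply: DP.
    by rewrite !ger0_norm ?tt// (le_trans t00).
  - rewrite (@integral_ray_right x t0 T)//; last by rewrite (le_trans _ t0T)// ler_norm.
    by rewrite /= normrN coord_upd_id.
apply: (@line_bound K f e x [set` `[- T, t0]]) => //.
- move=> t; rewrite /= in_itv/= => /andP[tT tt]; apply: DP.
  have t_0 : t <= 0 by rewrite (le_trans tt)// ltW.
  by rewrite (ler0_norm t_0) (ler0_norm (ltW t00)) ger0_norm// lerN2 tt lerNl.
- rewrite (@integral_ray_left x t0 T)// ?(ltW t00)//.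
    by rewrite /= coord_upd_id.
  by rewrite lerNl -(ltr0_norm t00).
Qed.

(** The inner sphere, or the midpoint of the line if they do not meet, cuts the
    part of the line in the shell into two segments. On each, the fundamental
    theorem of calculus leaves a boundary term at the cut, whose sign is favorable
    because F points outward. *)
Lemma integral_line_le0 e x : 0 < e ->
  (forall y, 0 < enorm y < 1 -> 0 <= y ord0 i -> 0 <= F y) ->
  (forall y, 0 < enorm y < 1 -> y ord0 i <= 0 -> F y <= 0) ->
  (\int[leb]_t ((EFin \o G) \_ (shell e)) (coord_upd x i t) <= 0)%E.
Proof.
move=> e0 Fpos Fneg.
have mGl := measurableT_comp (mGs e0) (measurable_coord_upd x i).
pose phi t := ((EFin \o G) \_ (shell e)) (coord_upd x i t).
pose t0 := Num.sqrt (Num.max 0 (e ^+ 2 - off_sqr x i)).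
have t00 : 0 <= t0 by exact: sqrtr_ge0.
have rt0 : enorm (coord_upd x i t0) ^+ 2 = Num.max (off_sqr x i) (e ^+ 2).
  rewrite enorm_sqr_line sqr_sqrtr ?le_max ?lexx//.
  by rewrite addr_maxr addr0 [_ + (_ - _)]addrC subrK.
have et0 : e <= enorm (coord_upd x i t0).
  rewrite -(@ler_pXn2r _ 2)// ?nnegrE ?enorm_ge0// ?(ltW e0)// rt0.
  by rewrite le_max lexx orbT.
(* the line enters the ball of radius e, if at all, at the parameters -t0, t0 *)
have shellP t : shell e (coord_upd x i t) -> t0 <= `|t|.
  move=> /andP[et _]; rewrite -[leLHS]ger0_norm// -(le_enorm_line x i).
  rewrite -(@ler_pXn2r _ 2)// ?nnegrE ?enorm_ge0// rt0 ge_max.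
  rewrite enorm_sqr_line lerDl sqr_ge0/= -enorm_sqr_line.
  by rewrite ler_pXn2r// ?nnegrE ?enorm_ge0// ltW.
have [r1|r1] := ltP (enorm (coord_upd x i t0)) 1; last first.
  rewrite integral0_eq// => t _; rewrite patchE; case: ifPn => //.
  rewrite inE => /[dup] /shellP; rewrite -[t0]ger0_norm// -(le_enorm_line x i).
  by move=> /(le_trans r1) t1 /andP[_]; rewrite ltNge t1.
have r0 : 0 < enorm (coord_upd x i t0) by rewrite (lt_le_trans e0).
have [T] := line_exit r1 R01; rewrite (ger0_norm t00) => t0T TR.
have T0 : 0 <= T by rewrite (le_trans t00).
have phi0 t : ~ (t0 <= `|t| <= T) -> phi t = 0%E.
  move=> tP; rewrite /phi patchE; case: ifPn => //; rewrite inE => /shellP tt /=.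
  rewrite G0//; case/andP: TR => + _; move=> /le_trans; apply.
  rewrite le_enorm_line (ger0_norm T0) ltW// ltNge; apply/negP => tT.
  by apply: tP; rewrite tt tT.
have phiG t : t0 <= `|t| <= T -> phi t = (G (coord_upd x i t))%:E.
  move=> /andP[tt tT]; rewrite /phi patchE mem_set//.
  rewrite -[t0]ger0_norm// -(le_enorm_line x i) in tt.
  rewrite -[T]ger0_norm// -(le_enorm_line x i) in tT.
  apply/andP; split; first exact: le_trans tt.
  by apply: (le_lt_trans tT); case/andP: TR.
(* phi vanishes on [0, +oo[ outside [t0, T] *)
have right_le0 : (\int[leb]_(t in `[0%R, +oo[) phi t <= 0)%E.
  have -> : (\int[leb]_(t in `[0%R, +oo[) phi t =
      \int[leb]_(t in `[t0, T]) (G (coord_upd x i t))%:E)%E.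
    rewrite [LHS]integral_mkcond [RHS]integral_mkcond; apply: eq_integral => t _.
    rewrite !patchE; case: ifPn => [|].
      rewrite inE/= in_itv/= andbT => tt.
      case: ifPn; [rewrite inE|rewrite notin_setE]; rewrite /= in_itv/= => tT.
        by rewrite phiG// ger0_norm.
      by rewrite phi0//; rewrite ger0_norm.
    rewrite notin_setE/= in_itv/= andbT => tt.
    case: ifPn => //; rewrite inE/= in_itv/= => /andP[tT _].
    by case: tt; rewrite (le_trans t00).
  rewrite integral_ray_right// lee_fin oppr_le0.
  by apply: Fpos; rewrite ?r0 ?coord_upd_same.
(* the point 0 is removed to keep the two half-lines disjoint when t0 = 0 *)
have left_le0 : (\int[leb]_(t in `]-oo, 0%R[) phi t <= 0)%E.
  have -> : (\int[leb]_(t in `]-oo, 0%R[) phi t =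
      \int[leb]_(t in [set` `[(- T)%R, (- t0)%R]] `\ 0%R) phi t)%E.
    rewrite [LHS]integral_mkcond [RHS]integral_mkcond; apply: eq_integral => t _.
    rewrite !patchE; case: ifPn => [|].
      rewrite inE/= in_itv/= => tt.
      case: ifPn => //; rewrite notin_setE/= in_itv/= => tT.
      rewrite phi0// => tT'; apply: tT; split; last by apply/eqP; rewrite lt_eqF.
      by move: tT'; rewrite ltr0_norm// lerNr andbC lerNl.
    rewrite notin_setE/= in_itv/= => tt.
    case: ifPn => //; rewrite inE/= in_itv/= => -[/andP[tT tt0] /eqP tN0].
    by case: tt; rewrite lt_neqAle tN0 (le_trans tt0)// oppr_le0.
  rewrite integral_setD1//=; last 2 first.
  - exact: measurableD.
  - exact: measurable_funTS mGl.
  have -> : (\int[leb]_(t in `[(- T)%R, (- t0)%R]) phi t =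
      \int[leb]_(t in `[(- T)%R, (- t0)%R]) (G (coord_upd x i t))%:E)%E.
    apply: eq_integral => t; rewrite inE/= in_itv/= => /andP[tT tt].
    rewrite phiG// ler0_norm ?(le_trans tt) ?oppr_le0//.
    by rewrite lerNr tt lerNl.
  rewrite integral_ray_left ?oppr_le0// ?lerN2 ?enorm_lineN// lee_fin.
  by apply: Fneg; rewrite ?enorm_lineN ?r0 ?coord_upd_same ?oppr_le0.
have <- : [set` `]-oo, 0%R[] `|` [set` `[0%R, +oo[] = [set: R].
  apply/seteqP; split => // t _ /=; rewrite !in_itv/= andbT.
  by case: (ltP t 0); [left|right].
rewrite integral_setU//=.
- exact: adde_le0.
- exact: (measurable_funTS mGl).
- apply/disj_setPS => t [/=]; rewrite !in_itv/= andbT => t0n t0p.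
  by move: t0n; rewrite ltNge t0p.
Qed.

End rays.

(** * Test functions *)

Section test_functions.
Context {R : realType} {n : nat}.
Implicit Types (u : 'rV[R]_n -> R) (x : 'rV[R]_n) (i : 'I_n).

Lemma continuous_test u : test_function u -> continuous u.
Proof. by case=> /(_ [::])[]. Qed.

Lemma derivable_test u x i : test_function u -> derivable u x (delta_mx ord0 i).
Proof. by case=> /(_ [::])[_ du] _ _; exact: du. Qed.

Lemma continuous_partial_test u i : test_function u -> continuous (partial i u).
Proof. by case=> /(_ [:: i])[]. Qed.

Lemma enorm_gradient_sqr u x : enorm (gradient u x) ^+ 2 = \sum_i partial i u x ^+ 2.
Proof. by rewrite enorm_sqr; apply: eq_bigr => i _; rewrite mxE. Qed.

Lemma partial_le_gradient u x i : `|partial i u x| <= enorm (gradient u x).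
Proof. by have := coord_le_enorm (gradient u x) i; rewrite mxE. Qed.

Lemma continuous_enorm_gradient_test u : test_function u ->
  continuous (fun x => enorm (gradient u x)).
Proof.
move=> tu x.
apply: (@continuous_comp _ _ _ (fun x => \sum_(i < n) gradient u x ord0 i ^+ 2) Num.sqrt).
  apply: (@continuous_big _ 'I_n +%R 0 xpredT _ _ (index_enum 'I_n)
    (fun i y => gradient u y ord0 i ^+ 2)).
    exact: add_continuous.
  move=> i _ {}x.
  apply: (@continuous_comp _ _ _ (fun y => gradient u y ord0 i) (fun t : R => t ^+ 2)).
    rewrite (_ : (fun y => _) = partial i u); first exact: continuous_partial_test.
    by apply/funext => y; rewrite mxE.
  exact: exprn_continuous.
exact: sqrt_continuous.
Qed.

(** R0 lies strictly between the largest norm on the support and 1, so that u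
    vanishes in a neighborhood of each point of norm at least R0. *)
Lemma test_function_radius u : test_function u ->
  exists2 R0 : R, R0 < 1 &
    forall x, R0 <= enorm x -> u x = 0 /\ gradient u x = 0.
Proof.
case=> _ cK KB; set K := closure _ in cK KB.
have outK x : ~ K x -> u x = 0 /\ gradient u x = 0.
  move=> Kx.
  have ux : \near x, u x = cst 0 x.
    have : nbhs x (~` K).
      by apply: open_nbhs_nbhs; split => //; rewrite openC; exact: closed_closure.
    apply: filterS => y Ky /=; apply/eqP/negPn/negP => uy.
    exact/Ky/subset_closure.
  split; first exact: nbhs_singleton ux.
  apply/rowP => i; rewrite !mxE /partial (near_eq_derive _ ux).
  exact: derive_cst.
have [K0|/set0P K0] := eqVneq K set0.
  by exists 0 => // x _; apply: outK; rewrite K0.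
have [|c cK' cmax] := EVT_max_rV K0 cK (f := @enorm R n).
  by apply: continuous_subspaceT; exact: continuous_enorm.
have c1 : enorm c < 1 by apply: KB; rewrite inE in cK'.
exists ((1 + enorm c) / 2); first by rewrite ltr_pdivrMr// mul1r ltrD2l.
move=> x; rewrite ler_pdivrMr// => cx; apply: outK => Kx.
have := cmax x; rewrite inE => /(_ Kx) xc.
by move: c1 cx xc; lra.
Qed.

End test_functions.

Section continuous_at_operations.
Context {R : realType} {T : topologicalType}.
Implicit Types (f g : T -> R) (x : T).

Lemma continuous_forM f g x : {for x, continuous f} -> {for x, continuous g} ->
  {for x, continuous (fun y => f y * g y)}.
Proof. by move=> cf cg; exact: cvgM. Qed.

Lemma continuous_forD f g x : {for x, continuous f} -> {for x, continuous g} ->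
  {for x, continuous (fun y => f y + g y)}.
Proof. by move=> cf cg; exact: cvgD. Qed.

Lemma continuous_forV f x : f x != 0 -> {for x, continuous f} ->
  {for x, continuous (fun y => (f y)^-1)}.
Proof. by move=> fx cf; exact: cvgV. Qed.

Lemma continuous_forX f n x : {for x, continuous f} ->
  {for x, continuous (fun y => f y ^+ n)}.
Proof.
move=> cf; apply: (@continuous_comp _ _ _ f (fun t : R => t ^+ n)) => //.
exact: exprn_continuous.
Qed.

Lemma continuous_for_cst (c : R) x : {for x, continuous (fun _ : T => c)}.
Proof. exact: cst_continuous. Qed.

End continuous_at_operations.

(** * The weighted Hardy inequality on shells *)

Section hardy.
Context {R : realType} {m : nat}.
Notation N := m.+2.
Notation mu := (@lebesgue_rowvec R N).
Implicit Types (u : 'rV[R]_N -> R) (x : 'rV[R]_N) (i : 'I_N).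
Variable a : R.
Hypothesis ha : a < (N%:R - 2) / 2.

Let s : R := - (2 * a + 2).
Let c0 : R := Num.min (N%:R - 2 - 2 * a) N%:R / 2.

Let c0_gt0 : 0 < c0.
Proof.
rewrite divr_gt0// lt_min ltr0n andbT subr_gt0.
by move: ha; rewrite ltr_pdivlMr// mulrC.
Qed.

(** The right-hand side is the divergence of the field x d^s rho^(N - 1), divided
    by d^s rho^(N - 1). Since d >= 2 |x|, the quotient |x| rho / d lies between 0
    and rho / 2, and |x|^2 rho = rho - 2. This leaves an affine function of rho,
    equal to N - 2 - 2 a > 0 at the origin, where rho = 2, if s < 0, and growing
    with rho. *)
Lemma divergence_coef_ge x : 0 < enorm x < 1 ->
  c0 * rho x <=
  N%:R + s * (enorm x * rho x / hyp_dist x) + m.+1%:R * (enorm x ^+ 2 * rho x).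
Proof.
move=> x01; have /andP[x0 x1] := x01.
have d0 := hyp_dist_gt0 x01.
rewrite sqr_enorm_rho//.
have rho2 := rho_ge2 x1.
set X := enorm x * rho x / hyp_dist x.
have rho0 := ltW (rho_gt0 x1).
have X0 : 0 <= X by apply: divr_ge0; [apply: mulr_ge0; [exact: enorm_ge0|exact: rho0]|exact: ltW].
have X1 : 2 * X <= rho x.
  rewrite /X mulrA ler_pdivrMr// mulrA [leRHS]mulrC.
  by rewrite ler_wpM2r ?hyp_dist_ge ?(ltW (rho_gt0 x1)).
have c1 : 2 * c0 <= N%:R - 2 - 2 * a by rewrite /c0 mulrC divfK// ge_min lexx.
have c2 : 2 * c0 <= N%:R by rewrite /c0 mulrC divfK// ge_min lexx orbT.
have Nm : N%:R = m.+1%:R + 1 :> R by rewrite -natr1.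
have m1 : 1 <= m.+1%:R :> R by rewrite ler1n.
have NE : N%:R + m.+1%:R * (rho x - 2) =
    rho x * (N%:R / 2) + (m.+1%:R - 1) * (rho x - 2) / 2 :> R by rewrite Nm; field.
have mr : 0 <= (m.+1%:R - 1) * (rho x - 2) by rewrite mulr_ge0// subr_ge0.
have [s0|s0] := leP 0 s.
  have sX : 0 <= s * X by rewrite mulr_ge0.
  have cr : 2 * c0 * rho x <= N%:R * rho x by rewrite ler_wpM2r// (le_trans _ rho2).
  by lra.
have sX : s * rho x <= s * (2 * X) by rewrite ler_nM2l.
have cr : 2 * c0 * rho x <= (N%:R - 2 - 2 * a) * rho x by rewrite ler_wpM2r// (le_trans _ rho2).
by rewrite /s in sX *; lra.
Qed.

Definition hardy_field u i x : R :=
  x ord0 i * (hyp_dist x `^ s * rho x ^+ m.+1 * u x ^+ 2).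

Definition hardy_deriv u i x : R :=
  hyp_dist x `^ s * rho x ^+ m.+1 *
  ((1 + s * (rho x / (enorm x * hyp_dist x)) * x ord0 i ^+ 2 +
    m.+1%:R * rho x * x ord0 i ^+ 2) * u x ^+ 2 +
   2 * x ord0 i * u x * partial i u x).

Lemma is_derive_hardy u i x t : test_function u -> 0 < enorm (coord_upd x i t) < 1 ->
  is_derive t 1 (fun z => hardy_field u i (coord_upd x i z))
    (hardy_deriv u i (coord_upd x i t)).
Proof.
move=> tu xt; have /andP[x0 x1] := xt.
have d0 := hyp_dist_gt0 xt.
have D1 := is_derive_hyp_dist_powR_line s x0 x1 d0.
have D2 := is_derive_rho_line x1.
have D3 : is_derive t 1 (fun z => u (coord_upd x i z)) _ :=
  is_derive_line (@derivable_test _ _ u (coord_upd x i t) i tu).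
rewrite (_ : (fun z => _) = (fun z => z * (hyp_dist (coord_upd x i z) `^ s *
    rho (coord_upd x i z) ^+ m.+1 * u (coord_upd x i z) ^+ 2))); last first.
  by apply/funext => z; rewrite /hardy_field coord_upd_same.
pose fD z := hyp_dist (coord_upd x i z) `^ s.
pose fr z := rho (coord_upd x i z).
pose fu z := u (coord_upd x i z).
have D2' : is_derive t 1 (fr ^+ m.+1) _ := @is_deriveX R R fr m.+1 t 1 _ D2.
have D3' : is_derive t 1 (fu ^+ 2) _ := @is_deriveX R R fu 2 t 1 _ D3.
have D12 : is_derive t 1 (fD * fr ^+ m.+1) _ := is_deriveM D1 D2'.
have D123 : is_derive t 1 (fD * fr ^+ m.+1 * fu ^+ 2) _ := is_deriveM D12 D3'.
have D := is_deriveM (is_derive_id t 1) D123.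
rewrite (_ : (fun z => _) = id * (fD * fr ^+ m.+1 * fu ^+ 2)); last first.
  by apply/funext => z; rewrite !exprfctE.
apply: is_derive_eq D _.
rewrite /hardy_deriv coord_upd_same !exprfctE !mulrfctE /fD /fr /fu /GRing.scale/=.
rewrite powRB ?(gt_eqF d0) ?implybT// powRr1 ?(ltW d0)//.
rewrite expr1 mulr1 [rho _ ^+ m.+1]exprS; field.
by rewrite !gt_eqF.
Qed.

Definition hardy_density u x : R := hyp_dist x `^ s * rho x ^+ N * u x ^+ 2.

Definition energy_density u x : R :=
  hyp_dist x `^ (- (2 * a)) * rho x ^+ m * enorm (gradient u x) ^+ 2.

Lemma continuous_hardy_deriv u i x : test_function u -> 0 < enorm x < 1 ->
  {for x, continuous (hardy_deriv u i)}.
Proof.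
move=> tu x01; have /andP[x0 x1] := x01; have d0 := hyp_dist_gt0 x01.
have cr := continuous_rho x1.
have ci : {for x, continuous (fun y : 'rV[R]_N => y ord0 i)} by exact: coord_continuous.
have cu : {for x, continuous u} by exact: continuous_test.
have cp : {for x, continuous (partial i u)} by exact: continuous_partial_test.
have ce : {for x, continuous (@enorm R N)} by exact: continuous_enorm.
have cd := continuous_hyp_dist x1.
have cs : {for x, continuous (fun y : 'rV[R]_N => hyp_dist y `^ s)}.
  exact: continuous_hyp_dist_powR.
rewrite /hardy_deriv.
apply: continuous_forM; first by apply: continuous_forM => //; exact: continuous_forX.
apply: continuous_forD.
  apply: continuous_forM; last exact: continuous_forX.
  apply: continuous_forD.
    apply: continuous_forD; first exact: continuous_for_cst.
    apply: continuous_forM; last exact: continuous_forX.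
    apply: continuous_forM; first exact: continuous_for_cst.
    apply: continuous_forM => //.
    apply: continuous_forV; first by rewrite mulf_neq0// gt_eqF.
    exact: continuous_forM.
  apply: continuous_forM; last exact: continuous_forX.
  by apply: continuous_forM => //; exact: continuous_for_cst.
apply: continuous_forM => //; apply: continuous_forM => //; apply: continuous_forM => //.
exact: continuous_for_cst.
Qed.

Lemma continuous_hardy_density u x : test_function u -> 0 < enorm x < 1 ->
  {for x, continuous (hardy_density u)}.
Proof.
move=> tu x01; have /andP[x0 x1] := x01.
apply: continuous_forM; last by apply: continuous_forX; exact: continuous_test.
apply: continuous_forM; first exact: continuous_hyp_dist_powR.
by apply: continuous_forX; exact: continuous_rho.
Qed.

Lemma continuous_energy_density u x : test_function u -> 0 < enorm x < 1 ->
  {for x, continuous (energy_density u)}.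
Proof.
move=> tu x01; have /andP[x0 x1] := x01.
apply: continuous_forM; last first.
  by apply: continuous_forX; exact: continuous_enorm_gradient_test.
apply: continuous_forM; first exact: continuous_hyp_dist_powR.
by apply: continuous_forX; exact: continuous_rho.
Qed.

Lemma energy_density_ge0 u x : enorm x < 1 -> 0 <= energy_density u x.
Proof.
move=> x1; rewrite /energy_density mulr_ge0 ?sqr_ge0// mulr_ge0 ?powR_ge0//.
by rewrite exprn_ge0// ltW// rho_gt0.
Qed.

Lemma hardy_density_ge0 u x : enorm x < 1 -> 0 <= hardy_density u x.
Proof.
move=> x1; rewrite /hardy_density mulr_ge0 ?sqr_ge0// mulr_ge0 ?powR_ge0//.
by rewrite exprn_ge0// ltW// rho_gt0.
Qed.

(** Young's inequality, with the weight la that gives up half of the divergence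
    term. *)
Lemma hardy_pointwise u x : 0 < enorm x < 1 ->
  c0 / 2 * hardy_density u x <=
  \sum_i hardy_deriv u i x + (2 * c0)^-1 * energy_density u x.
Proof.
move=> x01; have /andP[x0 x1] := x01; have d0 := hyp_dist_gt0 x01.
have r0 := rho_gt0 x1.
pose phi := hyp_dist x `^ s * rho x ^+ m.+1.
have phi0 : 0 <= phi by rewrite mulr_ge0 ?powR_ge0// exprn_ge0// ltW.
pose la := c0 * rho x / (2 * enorm x ^+ 2).
have la0 : 0 < la by apply: divr_gt0; apply: mulr_gt0 => //; exact: exprn_gt0.
pose Gr := enorm (gradient u x) ^+ 2.
have sumG : \sum_i hardy_deriv u i x >=
    phi * ((N%:R + s * (enorm x * rho x / hyp_dist x) +
             m.+1%:R * (enorm x ^+ 2 * rho x)) * u x ^+ 2 -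
           (la * enorm x ^+ 2 * u x ^+ 2 + la^-1 * Gr)).
  have -> : phi * ((N%:R + s * (enorm x * rho x / hyp_dist x) +
             m.+1%:R * (enorm x ^+ 2 * rho x)) * u x ^+ 2 -
           (la * enorm x ^+ 2 * u x ^+ 2 + la^-1 * Gr)) =
    \sum_i phi * ((1 + s * (rho x / (enorm x * hyp_dist x)) * x ord0 i ^+ 2 +
      m.+1%:R * rho x * x ord0 i ^+ 2) * u x ^+ 2 -
      (la * x ord0 i ^+ 2 * u x ^+ 2 + la^-1 * partial i u x ^+ 2)).
    rewrite -mulr_sumr; congr (_ * _).
    rewrite sumrB -mulr_suml !big_split/= -!mulr_sumr -mulr_suml -mulr_sumr.
    rewrite -enorm_sqr -enorm_gradient_sqr sumr_const card_ord /Gr.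
    by field; rewrite !gt_eqF.
  apply: ler_sum => i _; apply: ler_wpM2l => //; rewrite lerD2l.
  rewrite -subr_ge0 opprK.
  rewrite (_ : _ + _ = la^-1 * (la * x ord0 i * u x + partial i u x) ^+ 2).
    by rewrite mulr_ge0 ?sqr_ge0// invr_ge0 ltW.
  by field; rewrite gt_eqF.
apply: (@le_trans _ _ (phi * (c0 * rho x * u x ^+ 2 -
    (la * enorm x ^+ 2 * u x ^+ 2 + la^-1 * Gr)) + (2 * c0)^-1 * energy_density u x)); last first.
  rewrite lerD2r; apply: le_trans sumG; apply: ler_wpM2l => //; rewrite lerD2r.
  by apply: ler_wpM2r; [exact: sqr_ge0|exact: divergence_coef_ge].
have -> : phi * (c0 * rho x * u x ^+ 2 - (la * enorm x ^+ 2 * u x ^+ 2 + la^-1 * Gr)) =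
    c0 / 2 * hardy_density u x -
    (2 * c0)^-1 * (hyp_dist x `^ s * rho x ^+ m * Gr * (2 * enorm x) ^+ 2).
  rewrite /phi /la /hardy_density [rho x ^+ m.+2]exprSr [rho x ^+ m.+1]exprSr.
  by field; rewrite !gt_eqF.
rewrite -addrA lerDl addrC subr_ge0 ler_wpM2l//; first by rewrite invr_ge0 mulr_ge0// ltW.
rewrite /energy_density -/Gr.
have -> : hyp_dist x `^ (- (2 * a)) = hyp_dist x `^ s * hyp_dist x ^+ 2.
  rewrite -(powR_mulrn 2 (ltW d0)) -powRD ?(gt_eqF d0) ?implybT//.
  by congr (_ `^ _); rewrite /s; ring.
have key : (2 * enorm x) ^+ 2 <= hyp_dist x ^+ 2.
  rewrite ler_pXn2r// ?nnegrE ?(ltW d0)//; first exact: hyp_dist_ge.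
  by apply: mulr_ge0 => //; exact: enorm_ge0.
rewrite [leRHS](_ : _ = hyp_dist x `^ s * rho x ^+ m * Gr * hyp_dist x ^+ 2); last by ring.
apply: ler_wpM2l => //; apply: mulr_ge0; last exact: sqr_ge0.
by apply: mulr_ge0; [exact: powR_ge0|apply: exprn_ge0; exact: ltW].
Qed.

(** The integral of each partial derivative of the field is nonpositive, line by
    line; integrate the pointwise inequality. *)
Lemma hardy_shell u e : test_function u -> 0 < e ->
  (\int[mu]_(x in shell e) (hardy_density u x)%:E <=
   (c0 ^- 2)%:E * \int[mu]_(x in shell e) (energy_density u x)%:E)%E.
Proof.
move=> tu e0; have [R0 R01 u0] := test_function_radius tu.
have me := @measurable_shell R N e.
have iG i : mu.-integrable (shell e) (EFin \o hardy_deriv u i).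
  apply: (integrable_shell (R0 := R0)) => //.
    by move=> x; exact: continuous_hardy_deriv.
  move=> x /u0[ux _]; rewrite /hardy_deriv ux.
  by rewrite expr0n/= !mulr0 mul0r addr0 mulr0.
have iH : mu.-integrable (shell e) (EFin \o hardy_density u).
  apply: (integrable_shell (R0 := R0)) => //.
    by move=> x; exact: continuous_hardy_density.
  by move=> x /u0[ux _]; rewrite /hardy_density ux expr0n mulr0.
have iE : mu.-integrable (shell e) (EFin \o energy_density u).
  apply: (integrable_shell (R0 := R0)) => //.
    by move=> x; exact: continuous_energy_density.
  by move=> x /u0[_ gx]; rewrite /energy_density gx enorm0 expr0n mulr0.
have G_le0 i : (\int[mu]_(x in shell e) (hardy_deriv u i x)%:E <= 0)%E.
  rewrite integral_mkcond; apply: (integral_le0_lines (i := i)).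
    by apply/(measurable_restrictT _ _).1 => //; case/integrableP: (iG i).
  move=> x; apply: (@integral_line_le0 R N (hardy_field u i) (hardy_deriv u i) i R0) => //.
  - by move=> y t yt; exact: is_derive_hardy.
  - by move=> y y01; exact: continuous_hardy_deriv.
  - by move=> y /u0[uy _]; rewrite /hardy_field uy expr0n !mulr0.
  - move=> y /u0[uy _]; rewrite /hardy_deriv uy.
    by rewrite expr0n/= !mulr0 mul0r addr0 mulr0.
  - move=> y /andP[y0 y1] yi; rewrite mulr_ge0// mulr_ge0 ?sqr_ge0// mulr_ge0 ?powR_ge0//.
    by rewrite exprn_ge0// ltW// rho_gt0.
  - move=> y /andP[y0 y1] yi; rewrite mulr_le0_ge0// mulr_ge0 ?sqr_ge0// mulr_ge0 ?powR_ge0//.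
    by rewrite exprn_ge0// ltW// rho_gt0.
have iS : mu.-integrable (shell e) (fun x => \sum_i (hardy_deriv u i x)%:E)%E.
  by apply: (@integrable_sum _ _ _ mu (shell e) me _ _ _
    (fun i => EFin \o hardy_deriv u i)) => i _; exact: iG.
have icE := integrableZl me (2 * c0)^-1 iE.
have icH := integrableZl me (c0 / 2) iH.
have : (\int[mu]_(x in shell e) ((c0 / 2)%:E * (EFin \o hardy_density u) x) <=
    \int[mu]_(x in shell e) (\sum_i (hardy_deriv u i x)%:E +
       ((2 * c0)^-1)%:E * (EFin \o energy_density u) x))%E.
  apply: le_integral => //; first exact: integrableD.
  move=> x; rewrite inE => ex; rewrite sumEFin -!EFinM -EFinD lee_fin.
  exact: hardy_pointwise (shell_punctured e0 ex).
rewrite (integralZl me iH) (integralD me iS icE) (integralZl me iE).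
rewrite (integral_sum me (f := fun i => EFin \o hardy_deriv u i))//.
move=> H; have {}H := le_trans H (leeD2r _ (sume_le0 (fun i _ => G_le0 i) _)).
rewrite add0e in H.
have c20 : (0 <= (2 / c0)%:E :> \bar R)%E by rewrite lee_fin divr_ge0// ltW.
have := lee_wpmul2l c20 H; rewrite !muleA -!EFinM.
rewrite (_ : 2 / c0 * (c0 / 2) = 1) ?mul1e; last by field; rewrite gt_eqF.
by rewrite (_ : 2 / c0 * (2 * c0)^-1 = c0 ^- 2)//; field; rewrite gt_eqF.
Qed.

Lemma hardy_shell_constant : exists2 C : R, 0 < C &
  forall u e, test_function u -> 0 < e ->
  (\int[mu]_(x in shell e) (hardy_density u x)%:E <=
   C%:E * \int[mu]_(x in shell e) (energy_density u x)%:E)%E.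
Proof.
by exists (c0 ^- 2); [rewrite invr_gt0 exprn_gt0|exact: hardy_shell].
Qed.

End hardy.

(** * The weighted Sobolev inequality on shells *)

Section radial_monomials.
Context {R : realType}.

(** All densities have this shape, which is stable under products and powers:
    identities between them reduce to identities between exponents. *)
Definition monom (d v r al be ga : R) : R := d `^ al * v `^ be * r `^ ga.

Variables d v r : R.
Hypotheses (d0 : 0 < d) (v0 : 0 <= v) (r0 : 0 < r).

Lemma monom_ge0 al be ga : 0 <= monom d v r al be ga.
Proof. by rewrite /monom !mulr_ge0// powR_ge0. Qed.

Lemma monom_powR al be ga t :
  monom d v r al be ga `^ t = monom d v r (al * t) (be * t) (ga * t).
Proof.
by rewrite /monom !powRM ?mulr_ge0 ?powR_ge0// -!powRrM.
Qed.

Lemma monomM al be ga al' be' ga' : 0 <= be -> 0 <= be' -> 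
  monom d v r al be ga * monom d v r al' be' ga' =
  monom d v r (al + al') (be + be') (ga + ga').
Proof.
move=> b0 b'0; rewrite /monom mulrACA [X in X * _]mulrACA; congr (_ * _ * _).
- by rewrite -powRD// (gt_eqF d0) implybT.
- have [->|bN0] := eqVneq be 0; first by rewrite add0r powRr0 mul1r.
  by rewrite -powRD// gt_eqF// ltr_pwDl// lt0r bN0.
- by rewrite -powRD// (gt_eqF r0) implybT.
Qed.

End radial_monomials.

Section sobolev.
Context {R : realType} {m : nat}.
Notation N := m.+3.
Notation mu := (@lebesgue_rowvec R N).
Notation leb := (@lebesgue_measure R).
Implicit Types (u : 'rV[R]_N -> R) (x : 'rV[R]_N) (i : 'I_N).
Variable a : R.
Hypothesis ha : a < (N%:R - 2) / 2.

Let q : R := 2 * N%:R / m.+1%:R.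
Let g : R := 2 * m.+2%:R / m.+1%:R.

Let m1 : 0 < m.+1%:R :> R. Proof. by rewrite ltr0n. Qed.
Let m2E : m.+2%:R = m.+1%:R + 1 :> R. Proof. by rewrite -natr1. Qed.
Let m3E : N%:R = m.+1%:R + 2 :> R. Proof. by rewrite -natr1 m2E; ring. Qed.

Let g2 : 2 < g.
Proof. by rewrite /g ltr_pdivlMr// m2E; lra. Qed.

Let q0 : 0 < q.
Proof. by rewrite /q divr_gt0// mulr_gt0// ltr0n. Qed.

Let g0 : 0 < g. Proof. by rewrite (lt_trans _ g2). Qed.

Definition sobolev_density u x : R :=
  hyp_dist x `^ (- (a * q)) * `|u x| `^ q * rho x ^+ N.

(** The exponent g = 2 (N - 1) / (N - 2) is the one that Gagliardo's inequality
    raises to the critical exponent q = 2 N / (N - 2). The weight rho^(N - 1) is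
    left out: it increases with the norm, and is restored by the ray estimate. *)
Definition sobolev_field u x : R := hyp_dist x `^ (- (a * g)) * `|u x| `^ g.

Definition sobolev_deriv u i x : R :=
  - (a * g) * (hyp_dist x `^ (- (a * g) - 1) * (rho x * (x ord0 i / enorm x))) * `|u x| `^ g +
  hyp_dist x `^ (- (a * g)) * (g * (`|u x| `^ (g - 2) * u x) * partial i u x).

Definition sobolev_majorant u x : R :=
  rho x ^+ m.+2 *
  (`|a| * g * (hyp_dist x `^ (- (a * g) - 1) * rho x * `|u x| `^ g) +
   g * (hyp_dist x `^ (- (a * g)) * `|u x| `^ (g - 1) * enorm (gradient u x))).

Lemma is_derive_sobolev u i x t : test_function u -> 0 < enorm (coord_upd x i t) < 1 ->
  is_derive t 1 (fun z => sobolev_field u (coord_upd x i z))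
    (sobolev_deriv u i (coord_upd x i t)).
Proof.
move=> tu xt; have /andP[x0 x1] := xt.
have d0 := hyp_dist_gt0 xt.
have D1 := is_derive_hyp_dist_powR_line (- (a * g)) x0 x1 d0.
have D3 : is_derive t 1 (fun z => u (coord_upd x i z)) _ :=
  is_derive_line (@derivable_test _ _ u (coord_upd x i t) i tu).
pose fD z := hyp_dist (coord_upd x i z) `^ (- (a * g)).
pose fu z := u (coord_upd x i z).
have D3' : is_derive t 1 ((fun y : R => `|y| `^ g) \o fu) _ :=
  @is_derive1_comp R (fun y : R => `|y| `^ g) fu t _ _ (is_derive_norm_powR (fu t) g2) D3.
have D : is_derive t 1 (fD * ((fun y : R => `|y| `^ g) \o fu)) _ := is_deriveM D1 D3'.
apply: is_derive_eq D _.
rewrite /sobolev_deriv coord_upd_same /fD /fu /GRing.scale/=; ring.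
Qed.

Lemma continuous_sobolev_deriv u i x : test_function u -> 0 < enorm x < 1 ->
  {for x, continuous (sobolev_deriv u i)}.
Proof.
move=> tu x01; have /andP[x0 x1] := x01; have d0 := hyp_dist_gt0 x01.
have cr := continuous_rho x1.
have ci : {for x, continuous (fun y : 'rV[R]_N => y ord0 i)} by exact: coord_continuous.
have cu : {for x, continuous u} by exact: continuous_test.
have cp : {for x, continuous (partial i u)} by exact: continuous_partial_test.
have ce : {for x, continuous (@enorm R N)} by exact: continuous_enorm.
have cs s : {for x, continuous (fun y : 'rV[R]_N => hyp_dist y `^ s)}.
  exact: continuous_hyp_dist_powR.
rewrite /sobolev_deriv.
apply: continuous_forD.
  apply: continuous_forM.
    apply: continuous_forM; first exact: continuous_for_cst.
    apply: continuous_forM => //; apply: continuous_forM => //; apply: continuous_forM => //.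
    by apply: continuous_forV => //; rewrite gt_eqF.
  apply: (@continuous_comp _ _ _ u (fun y : R => `|y| `^ g)) => //.
  exact: continuous_norm_powR.
apply: continuous_forM => //; apply: continuous_forM => //.
apply: continuous_forM; first exact: continuous_for_cst.
apply: (@continuous_comp _ _ _ u (fun y : R => `|y| `^ (g - 2) * y)) => //.
by apply: continuous_norm_powRM; rewrite subr_gt0.
Qed.

Lemma continuous_norm_powR_test u s x : test_function u -> 0 < s ->
  {for x, continuous (fun y : 'rV[R]_N => `|u y| `^ s)}.
Proof.
move=> tu s0; apply: (@continuous_comp _ _ _ u (fun y : R => `|y| `^ s)).
  exact: continuous_test.
exact: continuous_norm_powR.
Qed.

Lemma continuous_sobolev_density u x : test_function u -> 0 < enorm x < 1 ->
  {for x, continuous (sobolev_density u)}.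
Proof.
move=> tu x01; have /andP[x0 x1] := x01.
apply: continuous_forM; last by apply: continuous_forX; exact: continuous_rho.
apply: continuous_forM; first exact: continuous_hyp_dist_powR.
exact: continuous_norm_powR_test.
Qed.

Lemma continuous_sobolev_field u x : test_function u -> 0 < enorm x < 1 ->
  {for x, continuous (sobolev_field u)}.
Proof.
move=> tu x01; have /andP[x0 x1] := x01.
apply: continuous_forM; first exact: continuous_hyp_dist_powR.
exact: continuous_norm_powR_test.
Qed.

Lemma continuous_sobolev_majorant u x : test_function u -> 0 < enorm x < 1 ->
  {for x, continuous (sobolev_majorant u)}.
Proof.
move=> tu x01; have /andP[x0 x1] := x01.
have cr := continuous_rho x1.
have cs s : {for x, continuous (fun y : 'rV[R]_N => hyp_dist y `^ s)}.
  exact: continuous_hyp_dist_powR.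
apply: continuous_forM; first exact: continuous_forX.
apply: continuous_forD.
  apply: continuous_forM; first exact: continuous_for_cst.
  apply: continuous_forM; last exact: continuous_norm_powR_test.
  exact: continuous_forM.
apply: continuous_forM; first exact: continuous_for_cst.
apply: continuous_forM; last exact: continuous_enorm_gradient_test.
apply: continuous_forM => //; apply: continuous_norm_powR_test => //.
by rewrite subr_gt0 (lt_trans _ g2)// ltrDl.
Qed.

Lemma sobolev_deriv_le u i x : 0 < enorm x < 1 ->
  rho x ^+ m.+2 * `|sobolev_deriv u i x| <= sobolev_majorant u x.
Proof.
move=> x01; have /andP[x0 x1] := x01; have := rho_gt0 x1.
rewrite /sobolev_deriv /sobolev_majorant; move: (rho x) => r r0.
move: (g) g0 g2 => h h0 h2.
apply: ler_wpM2l; first by rewrite exprn_ge0// ltW.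
apply: (le_trans (ler_normD _ _)); apply: lerD.
  rewrite !normrM normrN normrM (gtr0_norm h0) -mulrA.
  apply: ler_wpM2l; first by apply: mulr_ge0 => //; exact: ltW.
  rewrite !(ger0_norm (powR_ge0 _ _)) (gtr0_norm r0).
  apply: ler_wpM2r; first exact: powR_ge0.
  apply: ler_wpM2l; first exact: powR_ge0.
  rewrite -[leRHS]mulr1; apply: ler_wpM2l; first exact: ltW.
  by rewrite normfV (gtr0_norm x0) ler_pdivrMr// mul1r coord_le_enorm.
rewrite !normrM !(ger0_norm (powR_ge0 _ _)) (gtr0_norm h0).
rewrite mulrA mulrCA -!mulrA; apply: ler_wpM2l; first exact: ltW.
apply: ler_wpM2l; first exact: powR_ge0.
rewrite mulrA (_ : `|u x| `^ (h - 2) * `|u x| = `|u x| `^ (h - 1)).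
  by apply: ler_wpM2l; [exact: powR_ge0|exact: partial_le_gradient].
rewrite -[X in _ * X]powRr1// -powRD; first by congr (_ `^ _); ring.
by apply/implyP => /eqP E; move: h2; lra.
Qed.

Lemma sobolev_pointwise u i x e : test_function u -> 0 < e -> shell e x ->
  ((rho x ^+ m.+2 * sobolev_field u x)%:E <=
    \int[leb]_t ((EFin \o sobolev_majorant u) \_ (shell e)) (coord_upd x i t))%E.
Proof.
move=> tu e0 ex; have [R0 R01 u0] := test_function_radius tu.
have me := @measurable_shell R N e.
have F0 : 0 <= sobolev_field u x by rewrite mulr_ge0 ?powR_ge0.
rewrite -[X in (_ * X)%:E](ger0_norm F0).
apply: (@le_ray_integral R N (sobolev_field u) (sobolev_deriv u i) i R0 _ _ _ _
  (fun x => rho x ^+ m.+2) (sobolev_majorant u)) => //.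
- by move=> y t yt; exact: is_derive_sobolev.
- by move=> y y01; exact: continuous_sobolev_deriv.
- by move=> y /u0[uy _]; rewrite /sobolev_field uy normr0 (powR0 (lt0r_neq0 g0)) mulr0.
- apply/(measurable_restrictT _ _).1 => //; apply/measurable_EFinP.
  by apply: measurable_fun_shell => // y y01; exact: continuous_sobolev_majorant.
- by move=> y /andP[_ y1]; rewrite exprn_ge0// ltW// rho_gt0.
- move=> y z yz z1; rewrite ler_pXn2r// ?nnegrE ?le_rho// ltW// rho_gt0//.
  exact: le_lt_trans z1.
- by move=> y /(shell_punctured e0); exact: sobolev_deriv_le.
Qed.

(* rational identities between the exponents, in terms of M = N - 2 *)
Local Ltac exponents := rewrite ?m3E ?m2E; move: m1; move: (m.+1%:R : R) => M M0; field;
  rewrite ?gt_eqF ?addr_gt0//.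

Lemma sobolev_density_monom u x : 0 < enorm x < 1 ->
  sobolev_density u x = monom (hyp_dist x) `|u x| (rho x) (- (a * q)) q N%:R.
Proof.
by move=> /andP[_ x1]; rewrite /sobolev_density /monom powR_mulrn// ltW// rho_gt0.
Qed.

Lemma hardy_density_monom u x : 0 < enorm x < 1 ->
  hardy_density a u x = monom (hyp_dist x) `|u x| (rho x) (- (2 * a + 2)) 2 N%:R.
Proof.
move=> /andP[_ x1]; rewrite /hardy_density /monom !powR_mulrn//; last first.
  by rewrite ltW// rho_gt0.
by rewrite real_normK ?num_real// mulrAC.
Qed.

Lemma energy_density_monom u x : 0 < enorm x < 1 ->
  energy_density a u x =
  monom (hyp_dist x) (enorm (gradient u x)) (rho x) (- (2 * a)) 2 m.+1%:R.
Proof.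
move=> /andP[_ x1]; rewrite /energy_density /monom !powR_mulrn// ?enorm_ge0//.
  by rewrite mulrAC.
by rewrite ltW// rho_gt0.
Qed.

Lemma sobolev_field_powR u x : 0 < enorm x < 1 ->
  (rho x ^+ m.+2 * sobolev_field u x) `^ (1 + m.+2%:R^-1) = sobolev_density u x.
Proof.
move=> x01; have d0 := hyp_dist_gt0 x01; have /andP[x0 x1] := x01.
have r0 := rho_gt0 x1; have m2 : 0 < m.+2%:R :> R by rewrite ltr0n.
rewrite (_ : _ * _ = monom (hyp_dist x) `|u x| (rho x) (- (a * g)) g m.+2%:R); last first.
  by rewrite /monom powR_mulrn ?(ltW r0)// mulrC.
rewrite monom_powR ?normr_ge0//.
rewrite sobolev_density_monom//; congr monom.
all: by rewrite /q /g; exponents.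
Qed.

(** Each term of the majorant is a geometric mean with the Sobolev density, ready
    for the Cauchy-Schwarz inequality; the first one comes from the derivative of
    the weight and is controlled by the Hardy inequality. *)
Lemma sobolev_majorant_split u x : 0 < enorm x < 1 ->
  sobolev_majorant u x =
  `|a| * g * (sobolev_density u x `^ 2^-1 * hardy_density a u x `^ (1 - 2^-1)) +
  g * (sobolev_density u x `^ 2^-1 * energy_density a u x `^ (1 - 2^-1)).
Proof.
move=> x01; have d0 := hyp_dist_gt0 x01; have /andP[x0 x1] := x01.
have r0 := rho_gt0 x1.
have q20 : 0 <= q * 2^-1 by rewrite mulr_ge0// ltW.
rewrite sobolev_density_monom// hardy_density_monom// energy_density_monom//.
rewrite !monom_powR ?normr_ge0 ?enorm_ge0//.
rewrite (_ : 1 - 2^-1 = 2^-1 :> R); last by field.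
rewrite mulfV ?pnatr_eq0//.
rewrite monomM ?normr_ge0//.
rewrite /sobolev_majorant mulrDr; congr (_ + _).
  rewrite mulrCA; congr (_ * _); rewrite /monom.
  have -> : - (a * q) * 2^-1 + - (2 * a + 2) * 2^-1 = - (a * g) - 1.
    by rewrite /q /g; exponents.
  have -> : q * 2^-1 + 1 = g.
    by rewrite /q /g; exponents.
  have -> : N%:R * 2^-1 + N%:R * 2^-1 = N%:R :> R by field.
  by rewrite powR_mulrn ?(ltW r0)// [rho x ^+ N]exprSr; ring.
rewrite mulrCA; congr (_ * _).
rewrite /monom powRr1 ?enorm_ge0//.
transitivity (hyp_dist x `^ (- (a * q) * 2^-1 + - (2 * a) * 2^-1) * `|u x| `^ (q * 2^-1) *
    enorm (gradient u x) * rho x `^ (N%:R * 2^-1 + m.+1%:R * 2^-1)).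
  have -> : - (a * q) * 2^-1 + - (2 * a) * 2^-1 = - (a * g).
    by rewrite /q /g; exponents.
  have -> : q * 2^-1 = g - 1.
    by rewrite /q /g; exponents.
  have -> : N%:R * 2^-1 + m.+1%:R * 2^-1 = m.+2%:R :> R by exponents.
  by rewrite powR_mulrn ?(ltW r0)//; ring.
rewrite (powRD (x := hyp_dist x)) ?(gt_eqF d0) ?implybT//.
by rewrite (powRD (x := rho x)) ?(gt_eqF r0) ?implybT//; ring.
Qed.

(** The power of S on the right is N / (2 (N - 1)) < 1, so that a finite S can be
    absorbed in the left-hand side. *)
Lemma sobolev_selfimprove (S E K : R) : 0 <= S -> 0 <= E -> 0 < K ->
  S <= (K * (S `^ 2^-1 * E `^ 2^-1)) `^ (1 + m.+2%:R^-1) ->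
  S <= (K `^ (2 * N%:R / m.+1%:R)) * E `^ (N%:R / m.+1%:R).
Proof.
move=> S0 E0 K0; have m2 : 0 < m.+2%:R :> R by rewrite ltr0n.
have [->|SN0] := eqVneq S 0; first by rewrite mulr_ge0 ?powR_ge0.
have {SN0}S0 : 0 < S by rewrite lt0r SN0.
set t := 1 + _; rewrite !powRM ?mulr_ge0 ?powR_ge0 ?(ltW K0)// -!powRrM.
move=> H; have {}H : S `^ (1 - 2^-1 * t) <= K `^ t * E `^ (2^-1 * t).
  rewrite powRB ?(gt_eqF S0) ?implybT// powRr1 ?(ltW S0)//.
  by rewrite ler_pdivrMr ?powR_gt0//; apply: le_trans H _; rewrite -!mulrA [X in _ * X]mulrC.
pose k := 2 * m.+2%:R / m.+1%:R : R.
have k0 : 0 <= k by rewrite divr_ge0 ?mulr_ge0// ltW.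
have := ge0_ler_powR k0 (powR_ge0 _ _) (mulr_ge0 (powR_ge0 _ _) (powR_ge0 _ _)) H.
rewrite powRM ?powR_ge0// -!powRrM.
have -> : (1 - 2^-1 * t) * k = 1 by rewrite /t /k; exponents.
have -> : t * k = 2 * N%:R / m.+1%:R by rewrite /t /k; exponents.
have -> : 2^-1 * t * k = N%:R / m.+1%:R by rewrite /t /k; exponents.
by rewrite powRr1// ltW.
Qed.

Lemma sobolev_shell_constant : exists2 C : R, 0 < C &
  forall u e, test_function u -> 0 < e ->
  (\int[mu]_(x in shell e) (sobolev_density u x)%:E <=
   C%:E * (\int[mu]_(x in shell e) (energy_density a u x)%:E) `^ (N%:R / m.+1%:R))%E.
Proof.
have [CH CH0 hardy] := @hardy_shell_constant R m.+1 a ha.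
pose K := `|a| * g * CH `^ 2^-1 + g.
have K0 : 0 < K by rewrite /K ltr_wpDl// mulr_ge0 ?powR_ge0// mulr_ge0// ltW.
exists (K `^ (2 * N%:R / m.+1%:R)); first exact: powR_gt0.
move=> u e tu e0; have [R0 R01 u0] := test_function_radius tu.
have me := @measurable_shell R N e.
pose r (f : 'rV[R]_N -> R) : 'rV[R]_N -> \bar R := (EFin \o f) \_ (shell e).
have mr f := @measurable_restrict_shell R N e f e0.
have r_ge0 f := @restrict_shell_ge0 R N e f e0.
have iS : mu.-integrable (shell e) (EFin \o sobolev_density u).
  apply: (integrable_shell (R0 := R0)) => //.
    by move=> x; exact: continuous_sobolev_density.
  by move=> x /u0[ux _]; rewrite /sobolev_density ux normr0 (powR0 (lt0r_neq0 q0)) mulr0 mul0r.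
have iE : mu.-integrable (shell e) (EFin \o energy_density a u).
  apply: (integrable_shell (R0 := R0)) => //.
    by move=> x; exact: continuous_energy_density.
  by move=> x /u0[_ gx]; rewrite /energy_density gx enorm0 expr0n mulr0.
have S0 x : 0 < enorm x < 1 -> 0 <= sobolev_density u x.
  by move=> x01; rewrite sobolev_density_monom// monom_ge0.
have H0 x : 0 < enorm x < 1 -> 0 <= hardy_density a u x.
  by move=> /andP[_]; exact: hardy_density_ge0.
have E0 x : 0 < enorm x < 1 -> 0 <= energy_density a u x.
  by move=> /andP[_]; exact: energy_density_ge0.
have mS : measurable_fun setT (r (sobolev_density u)).
  by apply: mr => x; exact: continuous_sobolev_density.
have mH : measurable_fun setT (r (hardy_density a u)).
  by apply: mr => x; exact: continuous_hardy_density.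
have mE : measurable_fun setT (r (energy_density a u)).
  by apply: mr => x; exact: continuous_energy_density.
have mM : measurable_fun setT (r (sobolev_majorant u)).
  by apply: mr => x; exact: continuous_sobolev_majorant.
pose w x := rho x ^+ m.+2 * sobolev_field u x.
have mw : measurable_fun setT (r w).
  apply: mr => x x01; apply: continuous_forM; last exact: continuous_sobolev_field.
  by apply: continuous_forX; apply: continuous_rho; case/andP: x01.
have w0 x : 0 < enorm x < 1 -> 0 <= w x.
  move=> /andP[_ x1]; apply: mulr_ge0; last by apply: mulr_ge0; exact: powR_ge0.
  by apply: exprn_ge0; apply: ltW; exact: rho_gt0.
have M0 x : 0 < enorm x < 1 -> 0 <= sobolev_majorant u x.
  move=> x01; rewrite sobolev_majorant_split//.
  by apply: addr_ge0; apply: mulr_ge0; rewrite ?mulr_ge0 ?powR_ge0 ?(ltW g0).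
have wM i x : (r w x <= \int[leb]_t (r (sobolev_majorant u)) (coord_upd x i t))%E.
  rewrite {1}/r patchE; case: ifPn => [|_].
    by rewrite inE => ex; exact: sobolev_pointwise.
  by apply: integral_ge0 => t _; exact: r_ge0.
have := gagliardo_nirenberg mw mM (r_ge0 _ w0) (r_ge0 _ M0) wM.
have -> : (\int[mu]_x (r w x `^ (1 + m.+2%:R^-1)) =
    \int[mu]_(x in shell e) (sobolev_density u x)%:E)%E.
  rewrite [RHS]integral_mkcond; apply: eq_integral => x _; rewrite /r !patchE.
  case: ifPn => [|_].
    by rewrite inE => /(shell_punctured e0) x01 /=; rewrite sobolev_field_powR.
  by rewrite poweR0r// gt_eqF// addr_gt0// invr_gt0 ltr0n.
have intr f : (\int[mu]_x r f x = \int[mu]_(x in shell e) (f x)%:E)%E.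
  by rewrite [RHS]integral_mkcond.
pose SH x := (r (sobolev_density u) x `^ 2^-1 * r (hardy_density a u) x `^ (1 - 2^-1))%E.
pose SE x := (r (sobolev_density u) x `^ 2^-1 * r (energy_density a u) x `^ (1 - 2^-1))%E.
have mSH : measurable_fun setT SH by apply: emeasurable_funM; exact: measurable_fun_poweR.
have mSE : measurable_fun setT SE by apply: emeasurable_funM; exact: measurable_fun_poweR.
have SH0 x : (0 <= SH x)%E by rewrite mule_ge0// poweR_ge0.
have SE0 x : (0 <= SE x)%E by rewrite mule_ge0// poweR_ge0.
have ag0 : 0 <= `|a| * g by rewrite mulr_ge0// ltW.
have -> : (\int[mu]_x r (sobolev_majorant u) x =
    (`|a| * g)%:E * \int[mu]_x SH x + g%:E * \int[mu]_x SE x)%E.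
  rewrite -ge0_integralZl// -ge0_integralZl//; last by rewrite lee_fin ltW.
  rewrite -ge0_integralD//; first last.
  - exact: measurable_funeM.
  - by move=> x _; rewrite mule_ge0// lee_fin ltW.
  - exact: measurable_funeM.
  - by move=> x _; rewrite mule_ge0.
  apply: eq_integral => x _; rewrite /SH /SE /r !patchE; case: ifPn => [|_].
    by rewrite inE => /(shell_punctured e0) x01 /=; rewrite sobolev_majorant_split.
  by rewrite poweR0r ?invr_eq0 ?pnatr_eq0// mul0e !mule0 adde0.
have half0 : 0 <= 2^-1 :> R by rewrite invr_ge0 ler0n.
have half1 : 2^-1 <= 1 :> R by rewrite invf_le1// ler1n.
have := hoelder_geometric mu mS mH (r_ge0 _ S0) (r_ge0 _ H0) half0 half1.
have := hoelder_geometric mu mS mE (r_ge0 _ S0) (r_ge0 _ E0) half0 half1.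
rewrite -/SH -/SE !intr.
have hE := hardy u e tu e0.
have ih0 : (0 <= \int[mu]_(x in shell e) (hardy_density a u x)%:E)%E.
  by apply: integral_ge0 => x /(shell_punctured e0) ?; rewrite lee_fin H0.
have ie0 : (0 <= \int[mu]_(x in shell e) (energy_density a u x)%:E)%E.
  by apply: integral_ge0 => x /(shell_punctured e0) ?; rewrite lee_fin E0.
have is0 : (0 <= \int[mu]_(x in shell e) (sobolev_density u x)%:E)%E.
  by apply: integral_ge0 => x /(shell_punctured e0) ?; rewrite lee_fin S0.
have := integrable_fin_num me iS; have := integrable_fin_num me iE.
move: ie0 is0 hE => /=.
case: (\int[mu]_(x in shell e) (energy_density a u x)%:E)%E => // E.
case: (\int[mu]_(x in shell e) (sobolev_density u x)%:E)%E => // S.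
rewrite !lee_fin => E_ge0 S_ge0 hE _ _ hSE hSH main.
have halfE : 1 - 2^-1 = 2^-1 :> R by field.
rewrite halfE in hSE hSH.
have aux : (((`|a| * g)%:E * \int[mu]_x SH x + g%:E * \int[mu]_x SE x) <=
    (K * (S `^ 2^-1 * E `^ 2^-1))%:E)%E.
  rewrite /K mulrDl EFinD; apply: leeD.
    rewrite -mulrA [X in (_ <= X)%E]EFinM; apply: lee_wpmul2l => //.
    apply: (le_trans hSH); rewrite [leRHS](_ : _ = (S%:E `^ 2^-1 * (CH%:E * E%:E) `^ 2^-1))%E.
      by apply: lee_wpmul2l; [exact: poweR_ge0|exact: le_poweR].
    by rewrite -[(CH%:E * E%:E)%E]EFinM !poweR_EFin powRM ?(ltW CH0)// -EFinM; congr EFin; ring.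
  by rewrite [X in (_ <= X)%E]EFinM; apply: lee_wpmul2l; [rewrite lee_fin ltW|].
have t0 : 0 <= 1 + m.+2%:R^-1 :> R by rewrite addr_ge0// invr_ge0.
have iSH0 : (0 <= \int[mu]_x SH x)%E by apply: integral_ge0 => x _.
have iSE0 : (0 <= \int[mu]_x SE x)%E by apply: integral_ge0 => x _.
have I0 : (0 <= (`|a| * g)%:E * \int[mu]_x SH x + g%:E * \int[mu]_x SE x)%E.
  by apply: adde_ge0; apply: mule_ge0; rewrite ?lee_fin// ltW.
apply: sobolev_selfimprove => //; rewrite -lee_fin.
exact: (le_trans main (le_poweR t0 I0 aux)).
Qed.

End sobolev.

(** * From shells to the ball, and interpolation *)

Section exhaustion.
Context {R : realType} {n : nat}.
Notation mu := (@lebesgue_rowvec R n.+1).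
Notation pball := [set x : 'rV[R]_n.+1 | 0 < enorm x < 1].
Variable f : 'rV[R]_n.+1 -> R.
Hypothesis cf : forall x, 0 < enorm x < 1 -> {for x, continuous f}.

Let mp : measurable pball.
Proof. exact: measurable_open_rowvec open_punctured_ball. Qed.

Let mf : measurable_fun pball (EFin \o f).
Proof.
apply/measurable_EFinP; apply: measurable_fun_continuous_rowvec => //.
exact: open_punctured_ball.
Qed.

Lemma integral_punctured_ball :
  (\int[mu]_(x in poincare_ball) (f x)%:E = \int[mu]_(x in pball) (f x)%:E)%E.
Proof.
have -> : @poincare_ball R n.+1 = [set 0] `|` pball.
  apply/seteqP; split => [x x1|x [->|/andP[_ x1]]//]; last by rewrite /poincare_ball/= enorm0.
  have [x0|x0] := eqVneq (enorm x) 0; first by left; exact: enorm_eq0.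
  by right; apply/andP; split => //; rewrite lt0r x0 enorm_ge0.
rewrite integral_setU//=.
- rewrite [X in (X + _)%E](_ : _ = 0%E) ?add0e//.
  apply: null_set_integral (measurable_rowvec_set1 _) _ (lebesgue_rowvec_set1 _).
  exact: measurable_fun_set1.
- exact: measurable_rowvec_set1.
- apply/measurable_funU => //; first exact: measurable_rowvec_set1.
  by split => //; exact: measurable_fun_set1.
- by apply/disj_setPS => x [->]; rewrite /= enorm0 ltxx.
Qed.

Hypothesis f0 : forall x, 0 < enorm x < 1 -> 0 <= f x.

Lemma integral_shell_le_ball e : 0 < e ->
  (\int[mu]_(x in shell e) (f x)%:E <= \int[mu]_(x in poincare_ball) (f x)%:E)%E.
Proof.
move=> e0; rewrite integral_punctured_ball; apply: ge0_subset_integral => //.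
- exact: measurable_shell.
- by move=> x; exact: shell_punctured.
Qed.

(** Monotone convergence along the shells of inner radius 1 / (k + 1). *)
Lemma integral_ball_le (M : \bar R) :
  (forall e : R, 0 < e -> (\int[mu]_(x in shell e) (f x)%:E <= M)%E) ->
  (\int[mu]_(x in poincare_ball) (f x)%:E <= M)%E.
Proof.
move=> fM; rewrite integral_punctured_ball.
pose F (k : nat) : set 'rV[R]_n.+1 := shell k.+1%:R^-1.
have k0 (k : nat) : 0 < k.+1%:R^-1 :> R by rewrite invr_gt0 ltr0n.
have Fp k : F k `<=` pball by move=> x; exact: shell_punctured.
have -> : pball = \bigcup_k F k.
  apply/seteqP; split => [x /andP[x0 x1]|x [k _ /Fp]//].
  exists (Num.truncn (enorm x)^-1) => //; apply/andP; split => //.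
  rewrite -[leRHS]invrK lef_pV2 ?posrE ?invr_gt0//.
  by rewrite ltW// truncnS_gt.
have ndF : nondecreasing_seq F.
  move=> k l kl; apply/subsetPset => x /andP[kx x1]; apply/andP; split => //.
  by apply: le_trans kx; rewrite lef_pV2 ?posrE ?ltr0n// ler_nat.
have := @ge0_nondecreasing_set_cvg_integral _ _ R F (EFin \o f) mu ndF.
move=> /(_ (fun k => measurable_shell _)) H.
apply: cvge_to_le (H _ _) _.
- move=> k; apply: measurable_funS mf => //.
- by move=> k x /Fp x01; rewrite lee_fin f0.
- by apply: nearW => k; exact: fM.
Qed.
End exhaustion.

Section caffarelli_kohn_nirenberg.
Context {R : realType} {m : nat}.
Notation N := m.+3.
Notation mu := (@lebesgue_rowvec R N).
Implicit Types (u : 'rV[R]_N -> R) (x : 'rV[R]_N).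
Variables a b p : R.
Hypothesis ha : a < (N%:R - 2) / 2.
Hypothesis hab0 : 0 <= b - a.
Hypothesis hab1 : b - a <= 1.
Hypothesis hp : p = 2 * N%:R / (N%:R - 2 + 2 * (b - a)).

Let M : R := m.+1%:R.
Let M0 : 0 < M. Proof. by rewrite ltr0n. Qed.
Let NE : N%:R = M + 2 :> R. Proof. by rewrite /M -!natr1; ring. Qed.
Let D : R := M + 2 * (b - a).
Let D0 : 0 < D. Proof. by rewrite ltr_pwDl// mulr_ge0. Qed.
Let pE : p = 2 * (M + 2) / D. Proof. by rewrite hp NE /D addrK. Qed.
Let p0 : 0 < p. Proof. by rewrite pE divr_gt0// mulr_gt0// addr_gt0. Qed.

Definition ckn_density u x : R :=
  hyp_dist x `^ (- (b * p)) * `|u x| `^ p * rho x ^+ N.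

Let la : R := (1 - (b - a)) * M / D.

Let la0 : 0 <= la.
Proof. by rewrite divr_ge0 ?mulr_ge0 ?subr_ge0// ltW. Qed.

Local Ltac exponents := move: D0 M0; rewrite /la /D; move: (M) => M' D0' M0'; field;
  rewrite ?lt0r_neq0//.

Let la1E : 1 - la = (b - a) * (M + 2) / D.
Proof. by exponents. Qed.

Let la1 : la <= 1.
Proof.
rewrite -subr_ge0 la1E; apply: divr_ge0; last exact: ltW.
by apply: mulr_ge0 => //; rewrite addr_ge0// ltW.
Qed.

(** The density lies on the segment between the Sobolev (b = a) and the Hardy
    (b = a + 1) ones, at the parameter la that matches the powers of u. *)
Lemma ckn_density_interp u x : 0 < enorm x < 1 ->
  ckn_density u x = sobolev_density a u x `^ la * hardy_density a u x `^ (1 - la).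
Proof.
move=> x01; have d0 := hyp_dist_gt0 x01; have /andP[x0 x1] := x01.
have r0 := rho_gt0 x1.
rewrite sobolev_density_monom// hardy_density_monom// !monom_powR ?normr_ge0//.
have q0 : 0 <= 2 * N%:R / m.+1%:R :> R by rewrite divr_ge0// mulr_ge0.
rewrite monomM//; [|exact: mulr_ge0|by rewrite mulr_ge0// subr_ge0].
rewrite -[ckn_density u x]/(hyp_dist x `^ (- (b * p)) * `|u x| `^ p * rho x ^+ N).
rewrite -powR_mulrn ?(ltW r0)// -/(monom _ _ _ _ _ _).
rewrite -/M la1E NE pE; congr monom.
all: by exponents.
Qed.

Lemma continuous_ckn_density u x : test_function u -> 0 < enorm x < 1 ->
  {for x, continuous (ckn_density u)}.
Proof.
move=> tu x01; have /andP[x0 x1] := x01.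
apply: continuous_forM; last by apply: continuous_forX; exact: continuous_rho.
apply: continuous_forM; first exact: continuous_hyp_dist_powR.
exact: continuous_norm_powR_test.
Qed.

Lemma ckn_shell_constant : exists2 C : R, 0 < C &
  forall u e, test_function u -> 0 < e ->
  (\int[mu]_(x in shell e) (ckn_density u x)%:E <=
   C%:E * (\int[mu]_(x in shell e) (energy_density a u x)%:E) `^ (p / 2))%E.
Proof.
have [CS CS0 sobolev] := @sobolev_shell_constant R m a ha.
have [CH CH0 hardy] := @hardy_shell_constant R m.+1 a ha.
exists (CS `^ la * CH `^ (1 - la)); first by rewrite mulr_gt0// powR_gt0.
move=> u e tu e0; have me := @measurable_shell R N e.
pose r (f : 'rV[R]_N -> R) : 'rV[R]_N -> \bar R := (EFin \o f) \_ (shell e).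
have mr f := @measurable_restrict_shell R N e f e0.
have r_ge0 f := @restrict_shell_ge0 R N e f e0.
have S0 x : 0 < enorm x < 1 -> 0 <= sobolev_density a u x.
  by move=> x01; rewrite sobolev_density_monom// monom_ge0.
have H0 x : 0 < enorm x < 1 -> 0 <= hardy_density a u x.
  by move=> /andP[_]; exact: hardy_density_ge0.
have mS : measurable_fun setT (r (sobolev_density a u)).
  by apply: mr => x; exact: continuous_sobolev_density.
have mH : measurable_fun setT (r (hardy_density a u)).
  by apply: mr => x; exact: continuous_hardy_density.
have intr f : (\int[mu]_x r f x = \int[mu]_(x in shell e) (f x)%:E)%E.
  by rewrite [RHS]integral_mkcond.
have := hoelder_geometric mu mS mH (r_ge0 _ S0) (r_ge0 _ H0) la0 la1.
rewrite !intr.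
have -> : (\int[mu]_x (r (sobolev_density a u) x `^ la * r (hardy_density a u) x `^ (1 - la)) =
    \int[mu]_(x in shell e) (ckn_density u x)%:E)%E.
  rewrite [RHS]integral_mkcond; apply: eq_integral => x _; rewrite /r !patchE.
  case: ifPn => [|_].
    by rewrite inE => /(shell_punctured e0) x01 /=; rewrite ckn_density_interp.
  have [->|laN0] := eqVneq la 0; first by rewrite subr0 poweRe0 poweR0r ?oner_eq0// mule0.
  by rewrite poweR0r// mul0e.
move=> /le_trans; apply.
have hS := sobolev u e tu e0; have hH := hardy u e tu e0.
have iS0 : (0 <= \int[mu]_(x in shell e) (sobolev_density a u x)%:E)%E.
  by apply: integral_ge0 => x /(shell_punctured e0) ?; rewrite lee_fin S0.
have iH0 : (0 <= \int[mu]_(x in shell e) (hardy_density a u x)%:E)%E.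
  by apply: integral_ge0 => x /(shell_punctured e0) ?; rewrite lee_fin H0.
have iE0 : (0 <= \int[mu]_(x in shell e) (energy_density a u x)%:E)%E.
  apply: integral_ge0 => x /(shell_punctured e0)/andP[_ x1].
  by rewrite lee_fin energy_density_ge0.
move: iS0 iH0 iE0 hS hH.
set S := (\int[mu]_(x in shell e) (sobolev_density a u x)%:E)%E.
set H := (\int[mu]_(x in shell e) (hardy_density a u x)%:E)%E.
set E := (\int[mu]_(x in shell e) (energy_density a u x)%:E)%E.
move: S H E => S H E iS0 iH0 iE0 hS hH.
have laC : 0 <= 1 - la by rewrite subr_ge0.
have CS0' : (0 <= CS%:E)%E by rewrite lee_fin ltW.
have CH0' : (0 <= CH%:E)%E by rewrite lee_fin ltW.
apply: (@le_trans _ _ ((CS%:E * E `^ (N%:R / m.+1%:R)) `^ la * (CH%:E * E) `^ (1 - la))%E).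
  by apply: lee_pmul; rewrite ?poweR_ge0//; exact: le_poweR.
rewrite !poweRM ?poweR_ge0// -poweRrM muleACA !poweR_EFin -EFinM.
apply: lee_wpmul2l; first by rewrite lee_fin mulr_ge0// powR_ge0.
have pE' : p / 2 = N%:R / m.+1%:R * la + (1 - la).
  by rewrite la1E -/M NE pE; exponents.
rewrite pE' (@poweRD _ _ (N%:R / m.+1%:R * la) (1 - la))//.
by apply: add_neq0_poweRD_def; rewrite -pE' gt_eqF// divr_gt0.
Qed.

Lemma ckn_inequality : exists C : R, 0 < C /\
  forall u, test_function u ->
  ((hyp_integral (fun x => (hyp_dist x `^ (- (b * p)) * `|u x| `^ p)%R) `^ (2 / p))
   <= C%:E *
      hyp_integral (fun x =>
        (hyp_dist x `^ (- (2 * a)) * enorm (hyp_gradient u x) ^+ 2)%R))%E.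
Proof.
have [C C0 ckn] := ckn_shell_constant.
exists (C `^ (2 / p)); split; first exact: powR_gt0.
move=> u tu.
have ce x : 0 < enorm x < 1 -> {for x, continuous (energy_density a u)}.
  exact: continuous_energy_density.
have E0 x : 0 < enorm x < 1 -> 0 <= energy_density a u x.
  by move=> /andP[_]; exact: energy_density_ge0.
have -> : hyp_integral (fun x =>
      hyp_dist x `^ (- (2 * a)) * enorm (hyp_gradient u x) ^+ 2) =
    (\int[mu]_(x in poincare_ball) (energy_density a u x)%:E)%E.
  apply: eq_integral => x; rewrite inE => x1; have r0 := rho_gt0 x1; congr EFin.
  rewrite /energy_density /hyp_gradient.
  have -> : enorm ((rho x)^-1 *: gradient u x) ^+ 2 = (rho x)^-1 ^+ 2 * enorm (gradient u x) ^+ 2.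
    rewrite !enorm_sqr mulr_sumr; apply: eq_bigr => i _.
    by rewrite mxE exprMn.
  rewrite [rho x ^+ N]exprS [rho x ^+ m.+2]exprS; field.
  by rewrite gt_eqF.
have iE0 : (0 <= \int[mu]_(x in poincare_ball) (energy_density a u x)%:E)%E.
  by apply: integral_ge0 => x x1; rewrite lee_fin energy_density_ge0.
have p20 : 0 <= p / 2 by rewrite divr_ge0// ltW.
have bound : (hyp_integral (fun x => (hyp_dist x `^ (- (b * p)) * `|u x| `^ p)%R) <=
    C%:E * (\int[mu]_(x in poincare_ball) (energy_density a u x)%:E) `^ (p / 2))%E.
  apply: (@integral_ball_le R m.+2 (ckn_density u)).
  - by move=> x; exact: continuous_ckn_density.
  - by move=> x x01; rewrite ckn_density_interp// mulr_ge0// powR_ge0.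
  - move=> e e0; apply: le_trans (ckn u e tu e0) _.
    apply: lee_wpmul2l; first by rewrite lee_fin ltW.
    apply: le_poweR => //; last exact: integral_shell_le_ball.
    apply: integral_ge0 => x /(shell_punctured e0)/andP[_ x1].
    by rewrite lee_fin energy_density_ge0.
have p2 : 0 <= 2 / p by rewrite divr_ge0// ltW.
apply: (le_trans (le_poweR p2 _ bound)).
  apply: integral_ge0 => x x1; rewrite lee_fin mulr_ge0//.
    by rewrite mulr_ge0// powR_ge0.
  by rewrite exprn_ge0// ltW// rho_gt0.
rewrite poweRM ?poweR_ge0 ?lee_fin ?(ltW C0)// poweR_EFin -poweRrM.
have -> : p / 2 * (2 / p) = 1 by field; rewrite gt_eqF.
by rewrite poweRe1.
Qed.

End caffarelli_kohn_nirenberg.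

Theorem theorem1p1 (R : realType) (N : nat) (hN : (3 <= N)%N) (a b p : R)
    (ha : a < (N%:R - 2) / 2)
    (hab0 : 0 <= b - a) (hab1 : b - a <= 1)
    (hp : p = 2 * N%:R / (N%:R - 2 + 2 * (b - a))) :
  exists C : R, 0 < C /\
    forall u : 'rV[R]_N -> R, test_function u ->
      ((hyp_integral (fun x => (hyp_dist x `^ (- (b * p)) * `|u x| `^ p)%R)
          `^ (2 / p))
       <= C%:E *
          hyp_integral (fun x =>
            (hyp_dist x `^ (- (2 * a)) * enorm (hyp_gradient u x) ^+ 2)%R))%E.
Proof.
by case: N hN ha hp => [|[|[|m]]]// _ ha hp; exact: ckn_inequality ha hab0 hab1 hp.
Qed.
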